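(* Let $\mathcal O$ be a complete discrete valuation ring with field of fractions $K$ and finite residue field $\kappa$ of cardinality $q$, and let $\mathcal O'$ be the ring of integers of a finite extension $K'$ of $K$, with residue field $\kappa'$ of cardinality $q^r$. Assume that the extension $\mathcal O'/\mathcal O$ is unramified. Then Drinfeld's morphism $\boldsymbol u\colon \mathbb W_{\mathcal O}\times_{\mathcal O}\mathrm{Spec}(\mathcal O')\to \mathbb W_{\mathcal O'}$ restricted to special fibers (i.e. base changed to $\kappa'$) is a universal homeomorphism with pro-infinitesimal kernel isomorphic to $$\mathrm{Spec}\big(\kappa'[X_0,X_1,\dots]/(X_0,\dots,X_i^{q^{i(r-1)}},\dots)\big),$$ the ideal being generated by all $X_i^{q^{i(r-1)}}$, $i\ge 0$.
   Context: **Ramified Witt vectors.** Let $\mathcal O$ be a complete discrete valuation ring with finite residue field $\kappa$ of cardinality $q$ and fixed uniformizer $\pi$. For an $\mathcal O$-algebra $B$, $W_{\mathcal O}(B)$ is the set $B^{\mathbb N_0}$ endowed with the unique $\mathcal O$-algebra structure, functorial in $B$, such that for every $B$ the map $\Phi_B\colon W_{\mathcal O}(B)\to B^{\mathbb N_0}$, $\boldsymbol b=(b_n)_n\mapsto(\Phi_n(\boldsymbol b))_n$, with $\Phi_n(\boldsymbol b)=b_0^{q^n}+\pi b_1^{q^{n-1}}+\dots+\pi^n b_n$, is a homomorphism of $\mathcal O$-algebras ($B^{\mathbb N_0}$ on the right is the product ring, with $\mathcal O$ acting componentwise). $\mathbb W_{\mathcal O}=\mathrm{Spec}\,\mathcal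 O[X_0,X_1,\dots]$ is the ring scheme over $\mathcal O$ representing $B\mapsto W_{\mathcal O}(B)$. **Drinfeld's morphism.** Let $\mathcal O'$ be as in the statement, with fixed uniformizer $\varpi$, and let $\Phi'_n$ be the analogous polynomials for $\mathcal O'$ (with $\varpi,q^r$ in place of $\pi,q$). There is a unique morphism of $\mathcal O'$-ring schemes $\boldsymbol u=\boldsymbol u_{(\mathcal O,\mathcal O')}\colon \mathbb W_{\mathcal O}\times_{\mathcal O}\mathrm{Spec}(\mathcal O')\to\mathbb W_{\mathcal O'}$ such that $\Phi'_n(u_B(\boldsymbol b))=\Phi_{nr}(\boldsymbol b)$ for all $n\ge 0$, all $\mathcal O'$-algebras $B$ and all $\boldsymbol b\in W_{\mathcal O}(B)$, where $u_B\colon W_{\mathcal O}(B)\to W_{\mathcal O'}(B)$ is the induced map on $B$-sections. A pro-infinitesimal group scheme over a field is an affine group scheme that is an inverse limit of infinitesimal ones (finite group schemes whose underlying space is one point). The isomorphism describing the kernel is an isomorphism of $\kappa'$-schemes. *)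

(* Defs.v *)
From HB Require Import structures.
From mathcomp Require Import all_boot all_order all_algebra all_field.
From mathcomp Require Import boolp classical_sets topology_structure.
From mathcomp.multinomials Require Import monalg.

Set Implicit Arguments.
Unset Strict Implicit.
Unset Printing Implicit Defensive.

Import GRing.Theory.
Local Open Scope classical_set_scope.
Local Open Scope ring_scope.

Definition is_ideal (R : comPzRingType) (I : set R) : Prop :=
  [/\ I 0, forall x y, I x -> I y -> I (x + y) & forall a x, I x -> I (a * x)].

Definition principal (R : comPzRingType) (a : R) : set R :=
  [set x | exists b, x = b * a].

Definition ideal_gen (R : comPzRingType) (S : set R) : set R :=
  [set x | forall I : set R, is_ideal I -> S `<=` I -> I x].

(* MathComp's {ideal_quot _} only covers proper ideals of nontrivial rings given
   by a boolean predicate; this is the quotient of R by the ideal generated by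
   an arbitrary subset S. *)
Section Quotient.
Variables (R : comPzRingType) (S : set R).
Local Open Scope quotient_scope.
Local Notation J := (ideal_gen S).

Lemma ideal_gen_ideal : is_ideal J.
Proof.
split=> [I [] //|x y Jx Jy I iI SI|a x Jx I iI SI]; have [_ addI mulI] := iI.
  by apply: addI; [apply: Jx|apply: Jy].
by apply: mulI; apply: Jx.
Qed.

Definition quot_rel (x y : R) : bool := `[< J (x - y) >].

Lemma quot_rel_equiv : equiv_class_of quot_rel.
Proof.
have [J0 addJ mulJ] := ideal_gen_ideal.
have oppJ x : J x -> J (- x) by rewrite -mulN1r; apply: mulJ.
split=> [x|x y|y x z]; first by apply/asboolP; rewrite subrr.
  by apply/asboolP/asboolP => /oppJ; rewrite opprB.
move=> /asboolP Jxy /asboolP Jyz; apply/asboolP.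
by rewrite -[x](subrK y) -addrA; apply: addJ.
Qed.

Canonical quot_rel_equivrel := EquivRelPack quot_rel_equiv.

Definition quot : Type := {eq_quot quot_rel}.
HB.instance Definition _ : EqQuotient R quot_rel quot := EqQuotient.on quot.
HB.instance Definition _ := Choice.on quot.

Lemma quotP (x y : R) : \pi_(quot) x = \pi_(quot) y <-> J (x - y).
Proof.
split=> [/eqP|Jxy]; first by rewrite piE => /asboolP.
by apply/eqP; rewrite piE; apply/asboolP.
Qed.

Definition quot_add (a b : quot) : quot := \pi_(quot) (repr a + repr b).
Definition quot_opp (a : quot) : quot := \pi_(quot) (- repr a).
Definition quot_mul (a b : quot) : quot := \pi_(quot) (repr a * repr b).

Lemma quot_repr (x : R) : J (repr (\pi_(quot) x) - x).
Proof. by apply/quotP; rewrite reprK. Qed.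

Lemma quot_addE x y : quot_add (\pi_(quot) x) (\pi_(quot) y) = \pi_(quot) (x + y).
Proof.
have [_ addJ _] := ideal_gen_ideal; apply/quotP.
by rewrite opprD addrACA; apply: addJ; apply: quot_repr.
Qed.

Lemma quot_oppE x : quot_opp (\pi_(quot) x) = \pi_(quot) (- x).
Proof.
have [_ _ mulJ] := ideal_gen_ideal; apply/quotP.
by rewrite -opprD -mulN1r; apply: mulJ; apply: quot_repr.
Qed.

Lemma quot_mulE x y : quot_mul (\pi_(quot) x) (\pi_(quot) y) = \pi_(quot) (x * y).
Proof.
have [_ addJ mulJ] := ideal_gen_ideal; apply/quotP.
rewrite -[_ * _](subrK (repr (\pi_(quot) x) * y)) -mulrBr -addrA -mulrBl.
apply: addJ; first by apply: mulJ; apply: quot_repr.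
by rewrite mulrC; apply: mulJ; apply: quot_repr.
Qed.

Lemma quot_ind (P : quot -> Prop) : (forall x, P (\pi_(quot) x)) -> forall a, P a.
Proof. by move=> Ppi a; rewrite -[a]reprK. Qed.

Lemma quot_addA : associative quot_add.
Proof.
by elim/quot_ind=> x; elim/quot_ind=> y; elim/quot_ind=> z;
   rewrite !quot_addE addrA.
Qed.
Lemma quot_addC : commutative quot_add.
Proof. by elim/quot_ind=> x; elim/quot_ind=> y; rewrite !quot_addE addrC. Qed.
Lemma quot_add0 : left_id (\pi_(quot) 0 : quot) quot_add.
Proof. by elim/quot_ind=> x; rewrite quot_addE add0r. Qed.
Lemma quot_addN : left_inverse (\pi_(quot) 0 : quot) quot_opp quot_add.
Proof. by elim/quot_ind=> x; rewrite quot_oppE quot_addE addNr. Qed.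
HB.instance Definition _ :=
  GRing.isZmodule.Build quot quot_addA quot_addC quot_add0 quot_addN.

Lemma quot_mulA : associative quot_mul.
Proof.
by elim/quot_ind=> x; elim/quot_ind=> y; elim/quot_ind=> z;
   rewrite !quot_mulE mulrA.
Qed.
Lemma quot_mulC : commutative quot_mul.
Proof. by elim/quot_ind=> x; elim/quot_ind=> y; rewrite !quot_mulE mulrC. Qed.
Lemma quot_mul1 : left_id (\pi_(quot) 1 : quot) quot_mul.
Proof. by elim/quot_ind=> x; rewrite quot_mulE mul1r. Qed.
Lemma quot_mulD : left_distributive quot_mul quot_add.
Proof.
elim/quot_ind=> x; elim/quot_ind=> y; elim/quot_ind=> z.
by rewrite !(quot_mulE, quot_addE) mulrDl.
Qed.
HB.instance Definition _ := GRing.Zmodule_isComPzRing.Build quot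
  quot_mulA quot_mulC quot_mul1 quot_mulD.

Definition quot_proj (x : R) : quot := \pi_(quot) x.

Lemma quot_proj_zmod : zmod_morphism quot_proj.
Proof.
by move=> x y; rewrite /quot_proj -quot_addE -quot_oppE.
Qed.
Lemma quot_proj_monoid : monoid_morphism quot_proj.
Proof. by split=> // x y; rewrite /quot_proj -quot_mulE. Qed.
HB.instance Definition _ :=
  GRing.isZmodMorphism.Build R quot quot_proj quot_proj_zmod.
HB.instance Definition _ :=
  GRing.isMonoidMorphism.Build R quot quot_proj quot_proj_monoid.

End Quotient.

Definition is_prime_ideal (R : comPzRingType) (P : set R) : Prop :=
  [/\ is_ideal P, ~ P 1 & forall x y, P (x * y) -> P x \/ P y].

Record prime_spectrum (R : comPzRingType) := PrimeIdeal {
  prime_set :> set R;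
  prime_setP : is_prime_ideal prime_set
}.

HB.instance Definition _ (R : comPzRingType) := gen_eqMixin (prime_spectrum R).
HB.instance Definition _ (R : comPzRingType) :=
  gen_choiceMixin (prime_spectrum R).

Section Zariski.
Variable R : comPzRingType.

Definition zariski_closed (S : set R) : set (prime_spectrum R) :=
  [set P | S `<=` P].

Definition zariski_open (U : set (prime_spectrum R)) : Prop :=
  exists S : set R, U = ~` zariski_closed S.

Lemma zariski_openT : zariski_open setT.
Proof.
exists setT; rewrite -setC0; congr (~` _).
apply/seteqP; split=> // P PT; have [_ P1 _] := prime_setP P.
by case: P1; apply: PT.
Qed.

Lemma zariski_openI U V :
  zariski_open U -> zariski_open V -> zariski_open (U `&` V).
Proof.
move=> [S ->] [T ->]; exists [set x | exists s t, [/\ S s, T t & x = s * t]].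
rewrite -setCU; congr (~` _); apply/seteqP; split=> P.
  have [[_ _ mulP] _ _] := prime_setP P.
  move=> [SP|TP] _ [s [t [Ss Tt ->]]]; last by apply: mulP; apply: TP.
  by rewrite mulrC; apply: mulP; apply: SP.
move=> STP; have [_ _ primeP] := prime_setP P.
have [SP|nSP] := pselect (S `<=` P); [by left|right] => t Tt.
move/existsNP: nSP => [s /not_implyP[Ss nPs]].
by case: (primeP s t) => //; apply: STP; exists s, t.
Qed.

Lemma zariski_open_bigU (I : Type) (U : I -> set (prime_spectrum R)) :
  (forall i, zariski_open (U i)) -> zariski_open (\bigcup_i U i).
Proof.
move=> oU; have {oU} [S SU] := choice oU.
exists (\bigcup_i S i); apply/seteqP; split=> [P [i _]|P].
  by rewrite SU => nP SP; apply: nP => x Sx; apply: SP; exists i.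
apply: contra_notP => nU x [i _ Six]; apply: contrapT => nPx; apply: nU.
by exists i => //; rewrite SU => /(_ x Six).
Qed.

HB.instance Definition _ := isOpenTopological.Build (prime_spectrum R)
  zariski_openT zariski_openI zariski_open_bigU.

End Zariski.

Section SpecMap.
Variables (R S : comPzRingType) (f : {rmorphism R -> S}).

Lemma preimage_prime (P : prime_spectrum S) : is_prime_ideal (f @^-1` P).
Proof.
have [[P0 addP mulP] P1 primeP] := prime_setP P.
split; rewrite /preimage /= ?rmorph1 //; last first.
  by move=> x y /=; rewrite rmorphM; apply: primeP.
split=> [|x y|a x] /=; rewrite ?(rmorph0, rmorphD, rmorphM) //.
  exact: addP.
exact: mulP.
Qed.

Definition spec_map (P : prime_spectrum S) : prime_spectrum R :=
  PrimeIdeal (preimage_prime P).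

End SpecMap.

Definition homeomorphism (T U : topologicalType) (f : T -> U) : Prop :=
  exists g : U -> T, [/\ continuous f, continuous g, cancel f g & cancel g f].

(* A commutative k-algebra is a ring with a structure map from k, so that
   restriction of scalars is composition and the zero algebra is allowed. *)
Record algebra (k : comPzRingType) := Algebra {
  alg_ring :> comPzRingType;
  alg_map : {rmorphism k -> alg_ring}
}.

Record alg_hom (k : comPzRingType) (A B : algebra k) := AlgHom {
  alg_fun :> {rmorphism A -> B};
  alg_funP : forall c, alg_fun (alg_map A c) = alg_map B c
}.

Lemma alg_hom_ext (k : comPzRingType) (A B : algebra k) (f g : alg_hom A B) :
  f =1 g -> f = g.
Proof.
case: f g => [f fP] [g gP] /= fg.
have efg : f = g.
  case: f g fg {fP gP} => [f cf] [g cg] /= /funext fg.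
  case: _ / fg cg => cg.
  by case: cf cg => [[f1] [f2]] [[g1] [g2]];
     rewrite (Prop_irrelevance f1 g1) (Prop_irrelevance f2 g2).
by case: _ / efg gP => gP; rewrite (Prop_irrelevance fP gP).
Qed.

Definition alg_id (k : comPzRingType) (A : algebra k) : alg_hom A A :=
  @AlgHom k A A (idfun : {rmorphism A -> A}) (fun=> erefl).

Lemma alg_comp_subproof (k : comPzRingType) (A B C : algebra k)
  (g : alg_hom B C) (f : alg_hom A B) c : (g \o f) (alg_map A c) = alg_map C c.
Proof. by rewrite /= !alg_funP. Qed.

Definition alg_comp (k : comPzRingType) (A B C : algebra k)
    (g : alg_hom B C) (f : alg_hom A B) : alg_hom A C :=
  @AlgHom k A C (g \o f : {rmorphism A -> C}) (alg_comp_subproof g f).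

Definition restrict (k l : comPzRingType) (g : {rmorphism k -> l})
    (B : algebra l) : algebra k :=
  @Algebra k B (alg_map B \o g : {rmorphism k -> B}).

Lemma restrict_hom_subproof (k l : comPzRingType) (g : {rmorphism k -> l})
  (B C : algebra l) (h : alg_hom B C) c :
  h (alg_map (restrict g B) c) = alg_map (restrict g C) c.
Proof. by rewrite /= alg_funP. Qed.

Definition restrict_hom (k l : comPzRingType) (g : {rmorphism k -> l})
    (B C : algebra l) (h : alg_hom B C) :
    alg_hom (restrict g B) (restrict g C) :=
  @AlgHom k (restrict g B) (restrict g C) h (restrict_hom_subproof g h).

(* Schemes over k enter through their functors of points on k-algebras. *)
Record kfunctor (k : comPzRingType) := KFunctor {
  points :> algebra k -> Type;
  push : forall A B : algebra k, alg_hom A B -> points A -> points B;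
  push_id : forall A (x : points A), push (alg_id A) x = x;
  push_comp : forall A B C (g : alg_hom B C) (f : alg_hom A B) (x : points A),
    push (alg_comp g f) x = push g (push f x)
}.

Record kmorphism (k : comPzRingType) (F G : kfunctor k) := KMorphism {
  kmor :> forall B : algebra k, F B -> G B;
  kmor_natural : forall A B (h : alg_hom A B) (x : F A),
    kmor (push h x) = push h (kmor x)
}.

Definition isomorphic (k : comPzRingType) (F G : kfunctor k) : Prop :=
  exists f : kmorphism F G, forall B, bijective (f B).

Definition Spec (k : comPzRingType) (A : algebra k) : kfunctor k.
Proof.
apply: (@KFunctor k (alg_hom A) (fun B C h x => alg_comp h x)).
- by move=> B x; apply: alg_hom_ext.
- by move=> B C D g f x; apply: alg_hom_ext.
Defined.

Definition affine (k : comPzRingType) (F : kfunctor k) : Prop :=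
  exists A : algebra k, isomorphic F (Spec A).

(* Spec D, with the projections given by x and h, is F x_G Spec C. *)
Definition is_fiber_product (k : comPzRingType) (F G : kfunctor k)
    (f : kmorphism F G) (C : algebra k) (y : G C)
    (D : algebra k) (x : F D) (h : alg_hom C D) : Prop :=
  f D x = push h y /\
  forall (E : algebra k) (x' : F E) (h' : alg_hom C E), f E x' = push h' y ->
    exists! s : alg_hom D E, push s x = x' /\ alg_comp s h = h'.

(* For every affine Spec C -> G, the base change F x_G Spec C -> Spec C is a
   homeomorphism of the underlying spaces; a point y : G C is a morphism
   Spec C -> G by Yoneda.  Affine bases suffice, being a homeomorphism is local
   on the target. *)
Definition universal_homeomorphism (k : comPzRingType) (F G : kfunctor k)
    (f : kmorphism F G) : Prop :=
  forall (C : algebra k) (y : G C),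
    exists (D : algebra k) (x : F D) (h : alg_hom C D),
      is_fiber_product f y x h /\ homeomorphism (spec_map h).

Record group_functor (k : comPzRingType) := GroupFunctor {
  gfun :> kfunctor k;
  gmul : forall B : algebra k, gfun B -> gfun B -> gfun B;
  gone : forall B : algebra k, gfun B;
  ginv : forall B : algebra k, gfun B -> gfun B;
  gmulA : forall B, associative (@gmul B);
  gmul1 : forall B, left_id (gone B) (@gmul B);
  gmulV : forall B, left_inverse (gone B) (@ginv B) (@gmul B);
  push_gmul : forall B C (h : alg_hom B C) (x y : gfun B),
    push h (gmul x y) = gmul (push h x) (push h y)
}.

Record group_morphism (k : comPzRingType) (G H : group_functor k) :=
  GroupMorphism {
    gmor :> kmorphism G H;
    gmorM : forall B (x y : G B), gmor B (gmul x y) = gmul (gmor B x) (gmor B y)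
  }.

Definition infinitesimal (k : fieldType) (G : group_functor k) : Prop :=
  exists A : algebra k,
    [/\ isomorphic G (Spec A),
        exists (n : nat) (e : 'I_n -> A), forall a : A,
          exists c : 'I_n -> k, a = \sum_(i < n) alg_map A (c i) * e i
      & exists P : prime_spectrum A, forall Q : prime_spectrum A, Q = P].

Definition is_inverse_limit (k : comPzRingType) (G : group_functor k)
    (I : Type) (le : I -> I -> Prop) (S : I -> group_functor k)
    (tr : forall i j, le i j -> group_morphism (S j) (S i))
    (pr : forall i, group_morphism G (S i)) : Prop :=
  (forall i j (ij : le i j) (B : algebra k) (g : G B),
     tr i j ij B (pr j B g) = pr i B g) /\
  (forall (B : algebra k) (x : forall i, S i B),
     (forall i j (ij : le i j), tr i j ij B (x j) = x i) ->
     exists! g : G B, forall i, pr i B g = x i).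

Definition directed (I : Type) (le : I -> I -> Prop) : Prop :=
  [/\ exists i : I, True,
      forall i, le i i,
      forall i j l, le i j -> le j l -> le i l
    & forall i j, exists l, le i l /\ le j l].

Definition pro_infinitesimal (k : fieldType) (G : group_functor k) : Prop :=
  affine G /\
  exists (I : Type) (le : I -> I -> Prop) (S : I -> group_functor k)
    (tr : forall i j, le i j -> group_morphism (S j) (S i))
    (pr : forall i, group_morphism G (S i)),
    [/\ directed le,
        forall i, infinitesimal (S i),
        forall i (ii : le i i) (B : algebra k) (x : S i B), tr i i ii B x = x,
        forall i j l (ij : le i j) (jl : le j l) (il : le i l)
          (B : algebra k) (x : S l B),
          tr i j ij B (tr j l jl B x) = tr i l il B x
      & is_inverse_limit tr pr].

Record ring_functor (k : comPzRingType) := RingFunctor {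
  rpoints :> algebra k -> comPzRingType;
  rpush : forall A B : algebra k,
    alg_hom A B -> {rmorphism rpoints A -> rpoints B};
  rpush_id : forall A (x : rpoints A), rpush (alg_id A) x = x;
  rpush_comp : forall A B C (g : alg_hom B C) (f : alg_hom A B) (x : rpoints A),
    rpush (alg_comp g f) x = rpush g (rpush f x)
}.

Record ring_morphism (k : comPzRingType) (F G : ring_functor k) :=
  RingMorphism {
    rmor :> forall B : algebra k, {rmorphism F B -> G B};
    rmor_natural : forall A B (h : alg_hom A B) (x : F A),
      rmor B (rpush F h x) = rpush G h (rmor A x)
  }.

Definition ring_kfunctor (k : comPzRingType) (F : ring_functor k) :
    kfunctor k :=
  @KFunctor k (fun B => F B) (fun A B h x => rpush F h x)
    (@rpush_id k F) (@rpush_comp k F).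

Definition ring_kmorphism (k : comPzRingType) (F G : ring_functor k)
    (f : ring_morphism F G) : kmorphism (ring_kfunctor F) (ring_kfunctor G) :=
  @KMorphism k (ring_kfunctor F) (ring_kfunctor G) (fun B x => f B x)
    (@rmor_natural k F G f).

(* The points of F x_k Spec l over an l-algebra B are those of F over B seen as
   a k-algebra. *)
Definition base_change (k l : comPzRingType) (g : {rmorphism k -> l})
    (F : ring_functor k) : ring_functor l.
Proof.
apply: (@RingFunctor l (fun B => F (restrict g B))
          (fun A B h => rpush F (restrict_hom g h))).
- move=> A x; rewrite -[RHS](rpush_id x).
  by congr (rpush _ _ x); apply: alg_hom_ext.
- move=> A B C h f x; rewrite -rpush_comp.
  by congr (rpush _ _ x); apply: alg_hom_ext.
Defined.

Definition base_change_mor (k l : comPzRingType) (g : {rmorphism k -> l})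
    (F G : ring_functor k) (f : ring_morphism F G) :
    ring_morphism (base_change g F) (base_change g G) :=
  @RingMorphism l (base_change g F) (base_change g G)
    (fun B => f (restrict g B))
    (fun A B h x => rmor_natural f (restrict_hom g h) x).

Section Kernel.
Variables (k : comPzRingType) (F G : ring_functor k) (f : ring_morphism F G).

Definition ker_points (B : algebra k) : Type := {x : F B | f B x = 0}.

Lemma ker_ext B (x y : ker_points B) : sval x = sval y -> x = y.
Proof.
case: x y => [x xP] [y yP] /= xy; case: _ / xy yP => yP.
by rewrite (Prop_irrelevance xP yP).
Qed.

Definition ker_push (A B : algebra k) (h : alg_hom A B) (x : ker_points A) :
  ker_points B.
Proof.
exists (rpush F h (sval x)).
by rewrite rmor_natural (svalP x) rmorph0.
Defined.

Definition ker_kfunctor : kfunctor k.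
Proof.
apply: (@KFunctor k ker_points ker_push).
- by move=> A x; apply: ker_ext; rewrite /= rpush_id.
- by move=> A B C g h x; apply: ker_ext; rewrite /= rpush_comp.
Defined.

Definition ker_add B (x y : ker_points B) : ker_points B.
Proof.
exists (sval x + sval y).
by rewrite rmorphD (svalP x) (svalP y) addr0.
Defined.

Definition ker_zero B : ker_points B := exist _ 0 (rmorph0 (f B)).

Definition ker_opp B (x : ker_points B) : ker_points B.
Proof. by exists (- sval x); rewrite rmorphN (svalP x) oppr0. Defined.

(* The kernel of f as a homomorphism of additive group schemes. *)
Definition kernel : group_functor k.
Proof.
apply: (@GroupFunctor k ker_kfunctor ker_add ker_zero ker_opp).
- by move=> B x y z; apply: ker_ext; rewrite /= addrA.
- by move=> B x; apply: ker_ext; rewrite /= add0r.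
- by move=> B x; apply: ker_ext; rewrite /= addNr.
- by move=> B C h x y; apply: ker_ext; rewrite /= rmorphD.
Defined.

End Kernel.

Definition poly_alg (k : comNzRingType) : algebra k :=
  @Algebra k {malg k[{cmonom nat}]}
    (malgC : {rmorphism k -> {malg k[{cmonom nat}]}}).

Definition indet (k : comNzRingType) (i : nat) : poly_alg k := << ucm i >>.

Definition quot_alg (k : comPzRingType) (A : algebra k) (S : set A) :
    algebra k :=
  @Algebra k (quot S) (@quot_proj A S \o alg_map A : {rmorphism k -> quot S}).

Section Witt.
Variables (O : comPzRingType) (pi : O) (q : nat).

Definition ghost (B : algebra O) (n : nat) (b : nat -> B) : B :=
  \sum_(i < n.+1) alg_map B pi ^+ i * b i ^+ (q ^ (n - i)).

(* The ring scheme of ramified Witt vectors.  witt_coord identifies the set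
   underlying W_O(B) with B^N (so that the scheme is Spec O[X_0, X_1, ...]), and
   witt_ghost* say that Phi_B is a homomorphism of O-algebras.  This structure
   exists and is unique up to unique isomorphism when O is a complete discrete
   valuation ring, pi a uniformizer and q the cardinality of the residue field. *)
Record witt_scheme := WittScheme {
  witt_ring :> ring_functor O;
  witt_alg : forall B : algebra O, {rmorphism O -> witt_ring B};
  witt_push_alg : forall (B C : algebra O) (h : alg_hom B C) (c : O),
    rpush witt_ring h (witt_alg B c) = witt_alg C c;
  witt_coord : forall B : algebra O, witt_ring B -> nat -> B;
  witt_coord_bij : forall B : algebra O, bijective (@witt_coord B);
  witt_push_coord : forall (B C : algebra O) (h : alg_hom B C)
    (b : witt_ring B) (n : nat),
    witt_coord (rpush witt_ring h b) n = h (witt_coord b n);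
  witt_ghostD : forall (B : algebra O) (n : nat) (a b : witt_ring B),
    ghost n (witt_coord (a + b)) = ghost n (witt_coord a) + ghost n (witt_coord b);
  witt_ghostM : forall (B : algebra O) (n : nat) (a b : witt_ring B),
    ghost n (witt_coord (a * b)) = ghost n (witt_coord a) * ghost n (witt_coord b);
  witt_ghost_alg : forall (B : algebra O) (n : nat) (c : O),
    ghost n (witt_coord (witt_alg B c)) = alg_map B c
}.

End Witt.

Definition is_drinfeld (O O' : comPzRingType) (pi : O) (pi' : O') (q r : nat)
    (iota : {rmorphism O -> O'}) (W : witt_scheme pi q)
    (W' : witt_scheme pi' (q ^ r))
    (u : ring_morphism (base_change iota W) W') : Prop :=
  forall (B : algebra O') (n : nat) (b : W (restrict iota B)),
    ghost pi' (q ^ r) n (witt_coord (u B b)) =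
    ghost pi q (n * r) (witt_coord b) :> B.

(* This is the maximal ideal when R is local. *)
Definition nonunits (R : idomainType) : set R :=
  [set x | x \isn't a GRing.unit].

Definition is_dvr (R : idomainType) : Prop :=
  [/\ forall I : set R, is_ideal I -> exists a, I = principal a,
      is_ideal (@nonunits R)
    & exists2 x : R, x != 0 & nonunits x].

Definition is_uniformizer (R : idomainType) (pi : R) : Prop :=
  @nonunits R = principal pi.

Definition is_complete (R : idomainType) (pi : R) : Prop :=
  (forall x : R, (forall n, principal (pi ^+ n) x) -> x = 0) /\
  (forall x : nat -> R, (forall n, principal (pi ^+ n) (x n.+1 - x n)) ->
     exists l : R, forall n, principal (pi ^+ n) (l - x n)).

Definition is_residue_field (R : idomainType) (k : fieldType)
    (res : {rmorphism R -> k}) : Prop :=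
  (forall y, exists x, res x = y) /\ (forall x, res x = 0 <-> nonunits x).

(* j identifies O' with the integral closure of O in K', and iota is the
   resulting inclusion of O in O'. *)
Definition is_ring_of_integers (O : idomainType) (K' : fieldExtType {fraction O})
    (O' : idomainType) (j : {rmorphism O' -> K'}) (iota : {rmorphism O -> O'}) :
    Prop :=
  [/\ injective j,
      forall z : K', (exists x, j x = z) <->
        integralOver (in_alg K' \o @tofrac O) z
    & forall a : O, j (iota a) = in_alg K' (tofrac a)].

(* Residue fields are finite below, hence perfect: separability of the residue
   extension is automatic and unramified means that m_O generates m_O'. *)
Definition is_unramified (O O' : idomainType) (iota : {rmorphism O -> O'}) :
    Prop :=
  ideal_gen (iota @` @nonunits O) = @nonunits O'.

(* Main.v *)
Require Import Defs.
From HB Require Import structures.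
From mathcomp Require Import all_boot all_order all_algebra all_field.
From mathcomp Require Import boolp classical_sets topology_structure.
From mathcomp Require Import finmap zify.
From mathcomp.multinomials Require Import monalg.

(** Write [e n = q^(n(r-1))] and let [U_n] in [O'[X_0, X_1, ...]] be the [n]-th
    coordinate of Drinfeld's map at the universal Witt vector.  As [O'/O] is
    unramified, [pi = d pi'] with [d] a unit, and the identity
    [Phi'_n(U) = Phi_(nr)(X)] computes [pi'^n U_n] from [U_0, ..., U_(n-1)].
    Raising to the [q]-th power improves a congruence modulo [pi'^m] to one
    modulo [pi'^(m+1)], so modulo [pi'^(n+1)] one may replace each earlier [U_i]
    by its value modulo [pi'], and drop every [X_i] with [i > n].  The exponents
    that remain satisfy [nr - i = i(r-1) + r(n-i)]: each [X_i] enters through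
    [X_i^(e i)] only.  Since divisibility by [pi'^n] of a polynomial is not
    affected by the substitution of [X_i^(e i)] for [X_i], one gets
      [U_n = V_n(X_0^(e 0), ..., X_n^(e n))] modulo [pi'], where
      [V_n(Y) = d^n Y_n + (a polynomial in Y_0, ..., Y_(n-1))]
    (lemma [drinfeld_polynomial]).

    Over [kappa'] the triangular [V] is an automorphism of the infinite affine
    space.  Through it [W_O'] gets new coordinates, in which the special fibre
    of Drinfeld's map raises the [n]-th coordinate to the power [e n] (theorem
    [drinfeld_special_fiber]).  The three assertions are then read off.

    - A base change of such a map to [C] is the spectrum of [C] with roots of
      prime power order of some elements adjoined.  Each element of that ring
      has a power of exponent [p^m] coming from [C], and the kernel of the
      structure map is nil: the primes correspond, and the correspondence is a
      homeomorphism ([purely_inseparable_homeomorphism],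
      [frobenius_universal_homeomorphism]).
    - The kernel consists of the vectors with [b_n^(e n) = 0] for all [n], which
      is the functor of points of the displayed algebra ([Spec_truncated]).
    - The first [n] coordinates of a sum of Witt vectors depend only on the
      first [n] coordinates of the summands ([witt_coordD_agree]), so the
      kernel has quotient groups obtained by truncating at level [n].  The
      algebra of such a quotient has a finite monomial basis and nilpotent
      augmentation ideal, and the kernel is the limit of these quotients
      ([truncated_coords_pro_infinitesimal]). *)

Set Implicit Arguments.
Unset Strict Implicit.
Unset Printing Implicit Defensive.

Import GRing.Theory.
Local Open Scope classical_set_scope.
Local Open Scope ring_scope.

(** * Evaluation of polynomials and presented algebras *)

(** Locked, so that unification never compares the monomial of a variable with
    the trivial monomial of a constant. *)
HB.lock Definition mvar (R : comNzRingType) (I : choiceType) (i : I) :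
  {malg R[{cmonom I}]} := << ucm i >>.

Section Evaluation.
Variables (R : comNzRingType) (T : comPzRingType) (I : choiceType).
Variables (phi : {rmorphism R -> T}) (v : I -> T).
Implicit Types (g : {malg R[{cmonom I}]}) (m : {cmonom I}).

(** The target of evaluation may be the zero ring, as algebras may be zero. *)
Definition cmeval m : T := \prod_(i <- finsupp m) v i ^+ m i.

Lemma cmeval_widen (d : {fset I}) m :
  (finsupp m `<=` d)%fset -> cmeval m = \prod_(i <- d) v i ^+ m i.
Proof.
by move=> md; apply: big_fset_incl => // i _ /fsfun_dflt ->.
Qed.

Lemma cmeval1 : cmeval mone = 1.
Proof. by rewrite /cmeval mdom1 big_seq_fset0. Qed.

Lemma cmevalM : {morph cmeval : m1 m2 / mmul m1 m2 >-> m1 * m2}.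
Proof.
move=> m1 m2; rewrite {1}/cmeval mdomD.
rewrite (cmeval_widen (fsubsetUl _ (finsupp m2))).
rewrite (cmeval_widen (fsubsetUr (finsupp m1) _)).
by rewrite -big_split; apply: eq_bigr => i _; rewrite cmM exprD.
Qed.

Lemma cmevalU i : cmeval (ucm i) = v i.
Proof. by rewrite /cmeval mdomU big_seq_fset1 cmUU. Qed.

Definition meval g : T := \sum_(m <- msupp g) phi g@_m * cmeval m.

Lemma meval_widen (d : {fset {cmonom I}}) g :
  (msupp g `<=` d)%fset -> meval g = \sum_(m <- d) phi g@_m * cmeval m.
Proof.
move=> gd; apply: big_fset_incl => // m _ /mcoeff_outdom ->.
by rewrite rmorph0 mul0r.
Qed.

Lemma meval_is_zmod_morphism : zmod_morphism meval.
Proof.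
move=> g h; rewrite (meval_widen (msuppB_le g h)).
rewrite (meval_widen (fsubsetUl _ (msupp h))).
rewrite (meval_widen (fsubsetUr (msupp g) _)) -sumrB.
by apply: eq_bigr => m _; rewrite mcoeffB rmorphB mulrBl.
Qed.

HB.instance Definition _ :=
  GRing.isZmodMorphism.Build {malg R[{cmonom I}]} T meval
    meval_is_zmod_morphism.

Lemma mevalU c m : meval << c *g m >> = phi c * cmeval m.
Proof. by rewrite (meval_widen msuppU_le) big_seq_fset1 mcoeffUU. Qed.

Lemma meval_is_monoid_morphism : monoid_morphism meval.
Proof.
split=> [|g h]; first by rewrite mevalU rmorph1 cmeval1 mulr1.
rewrite malgME raddf_sum mulr_suml; apply: eq_bigr => m _.
rewrite raddf_sum mulr_sumr; apply: eq_bigr => n _.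
by rewrite [LHS]mevalU rmorphM cmevalM mulrACA.
Qed.

HB.instance Definition _ :=
  GRing.isMonoidMorphism.Build {malg R[{cmonom I}]} T meval
    meval_is_monoid_morphism.

Lemma mevalC c : meval c%:MP = phi c.
Proof. by rewrite mevalU cmeval1 mulr1. Qed.

Lemma mevalX i : meval (mvar R i) = v i.
Proof. by rewrite mvar.unlock mevalU rmorph1 mul1r cmevalU. Qed.

Lemma malg_lift : exists g : {rmorphism {malg R[{cmonom I}]} -> T},
  (forall c, g c%:MP = phi c) /\ (forall i, g (mvar R i) = v i).
Proof. by exists meval; split; [exact: mevalC|exact: mevalX]. Qed.

End Evaluation.

Lemma monomial_prod (I : choiceType) (R : comNzRingType) (m : {cmonom I}) :
  << m >> = \prod_(i <- finsupp m) mvar R i ^+ m i.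
Proof.
rewrite mvar.unlock.
pose e (f : {cmonom I}) := << f >> : {malg R[{cmonom I}]}.
have eM f g : e (mmul f g) = e f * e g.
  rewrite /e (_ : << f >> * << g >> = fgmul << f >> << g >>) //.
  by rewrite fgmulUU mulr1.
pose pw (f : {cmonom I}) n : {cmonom I} := iter n (mmul f) mone.
have eX f n : e (pw f n) = e f ^+ n.
  by elim: n => [|n IH]; rewrite ?expr0 // exprS -IH -eM.
under eq_bigr => i _ do rewrite -[<< ucm i >>]/(e (ucm i)) -eX.
rewrite -[LHS]/(e m) -(big_morph e eM (erefl (e mone))); congr e.
apply/eqP/cmP => j.
have pwE f n : pw f n j = (n * f j)%N.
  by elim: n => [|n IH]; rewrite ?cm1 // [LHS]cmM -/(pw f n) IH mulSn.
rewrite (big_morph (fun f : {cmonom I} => f j) (fun f g => cmM j f g) (cm1 j)).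
under eq_bigr => i _ do rewrite pwE cmU.
have [jm|jm] := boolP (j \in finsupp m); last first.
  rewrite (fsfun_dflt jm) big1_seq // => i /= im.
  by case: eqP jm => [<-|]; rewrite ?im ?muln0.
rewrite (big_fsetD1 j) //= eqxx muln1 big1_seq ?addn0 // => i /=.
by rewrite in_fsetD1 => /andP[/negbTE ij _]; rewrite ij muln0.
Qed.

(** Polynomials are generated as a ring by constants and variables; this is how
    closure properties are checked on a whole presented algebra. *)
Lemma malg_ind (I : choiceType) (R : comNzRingType)
    (P : {malg R[{cmonom I}]} -> Prop) :
  (forall c, P c%:MP) -> (forall i, P (mvar R i)) ->
  (forall f g, P f -> P g -> P (f + g)) ->
  (forall f g, P f -> P g -> P (f * g)) -> forall f, P f.
Proof.
move=> PC PX PD PM f; rewrite (monalgE f).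
have P1 : P 1 by have := PC 1.
apply: big_ind => [||m _]; [by have := PC 0; rewrite malgC0E|exact: PD|].
have -> : << f@_m *g m >> = (f@_m)%:MP * << m >> :> {malg R[{cmonom I}]}.
  rewrite (_ : _ * _ = fgmul (f@_m)%:MP << m >>) // fgmulUU mulr1.
  by rewrite mul1m.
apply: (PM); [exact: PC|rewrite monomial_prod; apply: big_ind => [||i _]].
- exact: P1.
- exact: PM.
- elim: (m i) => [|n IH]; first exact: P1.
  by rewrite exprS; apply: (PM); [apply: PX|].
Qed.

Section Presentation.
Variables (R : comPzRingType) (S : set R) (T : comPzRingType).

Lemma quot_projP (a : quot S) : exists x, quot_proj S x = a.
Proof. by elim/quot_ind: a => x; exists x. Qed.

Lemma quot_proj_eq0 (s : R) : S s -> quot_proj S s = 0.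
Proof.
move=> Ss; rewrite -(rmorph0 (quot_proj S)); apply/Defs.quotP.
by rewrite subr0 => J _; apply.
Qed.

Variable f : {rmorphism R -> T}.
Hypothesis fS : forall s, S s -> f s = 0.

Lemma ideal_gen_kernel x : ideal_gen S x -> f x = 0.
Proof.
move=> /(_ (f @^-1` [set 0])); apply; last by move=> s /fS.
split=> [|a b fa fb|a b fb]; rewrite /= ?rmorph0 //.
  by rewrite rmorphD fa fb addr0.
by rewrite rmorphM fb mulr0.
Qed.

(** Universal property of the quotient: [f] is evaluated at any representative,
    which does no harm as [f] kills the ideal generated by [S]. *)
Lemma quot_lift : exists g : {rmorphism quot S -> T},
  forall x, g (quot_proj S x) = f x.
Proof.
pose g (a : quot S) := f (repr a).
have gE x : g (quot_proj S x) = f x.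
  apply/eqP; rewrite -subr_eq0 -rmorphB ideal_gen_kernel //.
  exact: quot_repr.
have gB : zmod_morphism g.
  move=> a b; case: (quot_projP a) (quot_projP b) => x <- [y <-].
  by rewrite -rmorphB !gE rmorphB.
have gM : monoid_morphism g.
  split=> [|a b]; first by rewrite -(rmorph1 (quot_proj S)) gE rmorph1.
  case: (quot_projP a) (quot_projP b) => x <- [y <-].
  by rewrite -rmorphM !gE rmorphM.
pose z := GRing.isZmodMorphism.Build _ _ g gB.
pose m := GRing.isMonoidMorphism.Build _ _ g gM.
pose G : {rmorphism quot S -> T} := HB.pack g z m.
by exists G.
Qed.

End Presentation.

Section PresentationMalg.
Variables (R : comNzRingType) (I : choiceType) (S : set {malg R[{cmonom I}]}).
Variable T : comPzRingType.

Lemma malg_hom_ext (g h : {rmorphism {malg R[{cmonom I}]} -> T}) :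
  (forall c, g c%:MP = h c%:MP) -> (forall i, g (mvar R i) = h (mvar R i)) ->
  g =1 h.
Proof.
move=> gC gX; elim/malg_ind => // x y gx gy.
  by rewrite !rmorphD gx gy.
by rewrite !rmorphM gx gy.
Qed.

Lemma presented_hom_ext (g h : {rmorphism quot S -> T}) :
  (forall c, g (quot_proj S c%:MP) = h (quot_proj S c%:MP)) ->
  (forall i, g (quot_proj S (mvar R i)) = h (quot_proj S (mvar R i))) ->
  g =1 h.
Proof.
move=> gC gX a; case: (quot_projP a) => x <-.
exact: (@malg_hom_ext (g \o quot_proj S) (h \o quot_proj S)).
Qed.

End PresentationMalg.

(** * Frobenius and purely inseparable morphisms *)

Section Frobenius.
Variables (p : nat) (R : comPzRingType).
Hypotheses (p_prime : prime p) (pR0 : p%:R = 0 :> R).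

(** In the binomial expansion all inner coefficients are multiples of [p]. *)
Lemma exprD_prime (x y : R) : (x + y) ^+ p = x ^+ p + y ^+ p.
Proof.
case: p p_prime pR0 => [//|n] n_prime nR0.
rewrite exprDn big_ord_recl big_ord_recr /= /bump /= !add1n !subSS subn0 subnn.
rewrite bin0 binn !expr0 !mulr1n mul1r mulr1 big1 ?add0r // => i _.
rewrite /= /bump add1n; have /dvdnP[c ->] : (n.+1 %| 'C(n.+1, i.+1))%N.
  by apply: prime_dvd_bin => //=; rewrite ltnS.
by rewrite -mulr_natr natrM nR0 !mulr0.
Qed.

Definition frob (n : nat) (x : R) : R := x ^+ (p ^ n).

Lemma frobD n : {morph frob n : x y / x + y}.
Proof.
rewrite /frob; elim: n => [|n IH] x y; first by rewrite !expr1.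
by rewrite expnSr !exprM IH exprD_prime.
Qed.

Lemma frob_zmod n : zmod_morphism (frob n).
Proof.
move=> x y; apply: (addIr (frob n y)); rewrite -frobD subrK.
by rewrite subrK.
Qed.

Lemma frob_monoid n : monoid_morphism (frob n).
Proof. by split=> [|x y]; rewrite /frob ?expr1n ?exprMn. Qed.

Definition Frob n : {rmorphism R -> R} :=
  HB.pack (frob n) (GRing.isZmodMorphism.Build _ _ (frob n) (@frob_zmod n))
    (GRing.isMonoidMorphism.Build _ _ (frob n) (@frob_monoid n)).

Lemma FrobE n x : Frob n x = x ^+ (p ^ n).
Proof. by []. Qed.

End Frobenius.

Lemma prime_expr (R : comPzRingType) (P : prime_spectrum R) n (x : R) :
  prime_set P (x ^+ n) -> prime_set P x.
Proof.
have [_ P1 PM] := prime_setP P.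
by elim: n => [/P1//|n IH]; rewrite exprS => /PM[].
Qed.

Lemma prime_expr_gt0 (R : comPzRingType) (P : prime_spectrum R) n (x : R) :
  (0 < n)%N -> prime_set P x -> prime_set P (x ^+ n).
Proof.
have [[_ _ PM] _ _] := prime_setP P.
by case: n => // n _ Px; rewrite exprSr; apply: PM.
Qed.

Lemma spectrum_ext (R : comPzRingType) (P Q : prime_spectrum R) :
  (forall x, prime_set P x <-> prime_set Q x) -> P = Q.
Proof.
case: P Q => [P Pp] [Q Qp] /= PQ.
have E : P = Q by apply/seteqP; split=> x /PQ.
by case: _ / E Qp {PQ} => Qp; rewrite (Prop_irrelevance Pp Qp).
Qed.

Section PurelyInseparable.
Variables (p : nat) (C D : comPzRingType) (h : {rmorphism C -> D}).
Hypotheses (p_prime : prime p) (pD : p%:R = 0 :> D).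
Hypothesis h_surj : forall d, exists n c, d ^+ (p ^ n) = h c.
Hypothesis h_nil : forall c, h c = 0 -> exists n, c ^+ (p ^ n) = 0.

Let expn_p_gt0 n : (0 < p ^ n)%N. Proof. by rewrite expn_gt0 prime_gt0. Qed.

(** The only candidate for a prime of [D] above [Q]: a prime contains an element
    as soon as it contains one of its powers. *)
Definition radical_extension (Q : set C) : set D :=
  [set d | exists n c, d ^+ (p ^ n) = h c /\ Q c].

(** Membership in [radical_extension] does not depend on the power that is
    brought back to [C]: two of them, raised to a common exponent, have the same
    image in [D] and so differ by a nilpotent element, which lies in [Q]. *)
Lemma radical_extensionP (Q : prime_spectrum C) n c d :
  d ^+ (p ^ n) = h c -> radical_extension Q d -> prime_set Q c.
Proof.
move=> dc [m [c' [dc' Qc']]].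
have [[Q0 QD QM] _ _] := prime_setP Q.
have [l cl] : exists l, (c ^+ (p ^ m) - c' ^+ (p ^ n)) ^+ (p ^ l) = 0.
  by apply: h_nil; rewrite rmorphB !rmorphXn -dc -dc' -!exprM mulnC subrr.
apply: (@prime_expr _ _ (p ^ m)).
rewrite -[_ ^+ _](subrK (c' ^+ (p ^ n))); apply: QD.
  by apply: (@prime_expr _ _ (p ^ l)); rewrite cl.
exact: prime_expr_gt0.
Qed.

Lemma radical_extension_prime (Q : prime_spectrum C) :
  is_prime_ideal (radical_extension Q).
Proof.
have [[Q0 QD QM] Q1 Qprime] := prime_setP Q; split=> [|Q1'|x y].
- split=> [|x y [n [c [xc Qc]]] [m [d [yd Qd]]]|a x [n [c [xc Qc]]]].
  + by exists 0, 0; rewrite expr1 rmorph0.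
  + exists (n + m), (c ^+ (p ^ m) + d ^+ (p ^ n)); split.
      have := rmorphD (Frob p_prime pD (n + m)) x y; rewrite !FrobE => ->.
      rewrite rmorphD !rmorphXn -xc -yd.
      by rewrite -!exprM -!expnD (addnC m).
    by apply: QD; apply: prime_expr_gt0.
  + have [m [d ad]] := h_surj a.
    exists (n + m), (d ^+ (p ^ n) * c ^+ (p ^ m)); split; last first.
      by apply: QM; apply: prime_expr_gt0.
    rewrite exprMn rmorphM !rmorphXn -xc -ad -!exprM -!expnD.
    by rewrite (addnC m).
- apply: Q1; apply: (@radical_extensionP Q 0 1 1) Q1'.
  by rewrite expr1n rmorph1.
- move=> xy; have [n [c xc]] := h_surj x; have [m [d yd]] := h_surj y.
  have [] : prime_set Q (c ^+ (p ^ m)) \/ prime_set Q (d ^+ (p ^ n)).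
    apply: Qprime; apply: (@radical_extensionP Q (n + m) _ (x * y)) => //.
    rewrite exprMn rmorphM !rmorphXn -xc -yd -!exprM -!expnD.
    by rewrite (addnC m).
  + by move=> /prime_expr Qc; left; exists n, c.
  + by move=> /prime_expr Qd; right; exists m, d.
Qed.

(** The preimage of primes under [h] is inverted by [radical_extension].  The
    inverse is continuous because the closed set defined by [S] corresponds to
    the one defined by the elements of [C] that become powers of elements of
    [S]. *)
Lemma purely_inseparable_homeomorphism : homeomorphism (spec_map h).
Proof.
exists (fun Q => PrimeIdeal (radical_extension_prime Q)); split.
- apply/continuousP => _ [S ->]; exists (h @` S).
  apply/seteqP; split=> P /= nS; apply: contra_not nS => SP.
    by move=> s Ss; apply: SP; exists s.
  by move=> _ [s Ss <-]; apply: SP.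
- apply/continuousP => _ [S ->].
  exists [set c | exists n d, S d /\ d ^+ (p ^ n) = h c].
  apply/seteqP; split=> Q /= nS; apply: contra_not nS => SQ.
    move=> d Sd; have [n [c dc]] := h_surj d; exists n, c.
    by split=> //; apply: SQ; exists n, d.
  move=> c [n [d [Sd dc]]]; apply: radical_extensionP dc _.
  exact: SQ.
- move=> P; apply: spectrum_ext => d /=; split=> [[n [c [dc Pc]]]|Pd].
    by apply: (@prime_expr _ _ (p ^ n)); rewrite dc.
  have [n [c dc]] := h_surj d; exists n, c; split=> //.
  by rewrite /preimage /= -dc; apply: prime_expr_gt0.
- move=> Q; apply: spectrum_ext => c /=; split=> [|Qc].
    by apply: (@radical_extensionP Q 0); rewrite expr1.
  by exists 0, c; rewrite expr1.
Qed.

End PurelyInseparable.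

(** * Maps given by prime powers on coordinates *)

(** Polynomial rings need a base with [1 != 0]. *)
Lemma nonzero_comNzRing (R : comPzRingType) :
  1 != 0 :> R -> exists R' : comNzRingType, R = R' :> comPzRingType.
Proof.
case: R => T c; set R := GRing.ComPzRing.Pack c => R1.
pose nz := GRing.PzSemiRing_isNonZero.Build R R1.
pose R' : comNzRingType := HB.pack T c nz.
by exists R'.
Qed.

Definition natural_coords (k : comPzRingType) (F : kfunctor k)
    (x : forall B : algebra k, F B -> nat -> B) : Prop :=
  forall (A B : algebra k) (h : alg_hom A B) (a : F A) n,
    x B (push h a) n = h (x A a n).

Section FrobeniusOnCoordinates.
Variables (k : comPzRingType) (p : nat) (s : nat -> nat).
Variables (F G : kfunctor k) (f : kmorphism F G).
Variables (x : forall B : algebra k, F B -> nat -> B).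
Variables (w : forall B : algebra k, G B -> nat -> B).
Hypotheses (p_prime : prime p) (pk0 : p%:R = 0 :> k).
Hypotheses (x_nat : natural_coords x) (w_nat : natural_coords w).
Hypotheses (x_bij : forall B, bijective (@x B)).
Hypotheses (w_inj : forall B, injective (@w B)).
Hypothesis fE : forall B (b : F B) n, w (f B b) n = x b n ^+ (p ^ s n).

Let algebra_p0 (B : algebra k) : p%:R = 0 :> B.
Proof. by rewrite -(rmorph_nat (alg_map B)) pk0 rmorph0. Qed.

Section NonzeroBase.
Variables (R : comNzRingType) (a : {rmorphism k -> R}) (y : nat -> R).
Let C := @Algebra k R a.
Local Notation RX := {malg R[{cmonom nat}]}.
Local Notation X i := (mvar R i).

(** The fibre product of the map with [y : Spec C -> G] classifies the points of
    [F] with [x_n^(p^(s n)) = y_n], that is, it adjoins these roots to [C]. *)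
Definition root_relations : set RX :=
  [set X n ^+ (p ^ s n) - (y n)%:MP | n in [set: nat]].

Definition adjoin_roots : algebra k :=
  @Algebra k (quot root_relations)
    (quot_proj root_relations \o (@malgC _ R \o a) : {rmorphism k -> quot _}).

Definition adjoin_inj : alg_hom C adjoin_roots :=
  @AlgHom k C adjoin_roots
    (quot_proj root_relations \o @malgC _ R : {rmorphism R -> quot _})
    (fun=> erefl).

Lemma adjoin_rootE n :
  quot_proj root_relations (X n) ^+ (p ^ s n) = adjoin_inj (y n).
Proof.
apply/eqP; rewrite -subr_eq0 -rmorphXn -rmorphB; apply/eqP.
by apply: quot_proj_eq0; exists n.
Qed.

(** For large [N] the ring morphism [C[X] -> C] that is the [N]-th iterate of
    Frobenius on [C] and maps [X_n] to [y_n^(p^(N - s n))] kills the [n]-th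
    relation.  An element of the relation ideal involves finitely many of them,
    so a constant in it has a vanishing power. *)
Lemma adjoin_inj_nil c : adjoin_inj c = 0 -> exists n, c ^+ (p ^ n) = 0.
Proof.
have pR0 := algebra_p0 C.
have lift N := malg_lift (Frob p_prime pR0 N) (fun i => y i ^+ (p ^ (N - s i))).
have [th thP] := choice lift.
have thC N e : th N e%:MP = e ^+ (p ^ N) by case: (thP N) => ->.
have thX N i : th N (X i) = y i ^+ (p ^ (N - s i)) by case: (thP N) => _ ->.
pose I : set RX := [set g | exists N, forall M, (N <= M)%N -> th M g = 0].
have idI : is_ideal I.
  split=> [|g g' [N gN] [N' gN']|b g [N gN]].
  - by exists 0 => M _; rewrite rmorph0.
  - exists (maxn N N') => M; rewrite geq_max => /andP[NM NM'].
    by rewrite rmorphD gN // gN' // addr0.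
  - by exists N => M NM; rewrite rmorphM gN // mulr0.
have SI : root_relations `<=` I.
  move=> _ [n _ <-]; exists (s n) => M nM.
  by rewrite rmorphB rmorphXn thX thC -exprM -expnD subnK ?subrr.
move=> /eqP; rewrite /= -(rmorph0 (quot_proj root_relations)) => /eqP.
move=> /Defs.quotP; rewrite subr0 => /(_ I idI SI) [N /(_ N (leqnn N))].
by rewrite thC => cN; exists N.
Qed.

(** True for constants and for the adjoined roots, and inherited by sums and
    products since Frobenius is a ring morphism. *)
Lemma adjoin_roots_radical (d : adjoin_roots) :
  exists n c, d ^+ (p ^ n) = adjoin_inj c.
Proof.
have pD0 := algebra_p0 adjoin_roots.
case: (quot_projP d) => g <- {d}; elim/malg_ind: g => [c|i|g h|g h].
- by exists 0, c; rewrite expr1.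
- by exists (s i), (y i); rewrite adjoin_rootE.
- move=> [n [c gc]] [m [d hd]]; exists (n + m), (c ^+ (p ^ m) + d ^+ (p ^ n)).
  have := rmorphD (Frob p_prime pD0 (n + m)) (quot_proj _ g) (quot_proj _ h).
  rewrite !FrobE rmorphD => ->.
  rewrite rmorphD !rmorphXn -gc -hd.
  by rewrite -!exprM -!expnD (addnC m).
- move=> [n [c gc]] [m [d hd]]; exists (n + m), (c ^+ (p ^ m) * d ^+ (p ^ n)).
  rewrite (rmorphM (quot_proj root_relations)) exprMn rmorphM !rmorphXn -gc -hd.
  by rewrite -!exprM -!expnD (addnC m).
Qed.

Lemma adjoin_roots_lift (E : algebra k) (h : alg_hom C E) (z : nat -> E) :
  (forall n, z n ^+ (p ^ s n) = h (y n)) ->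
  exists t : alg_hom adjoin_roots E,
    alg_comp t adjoin_inj = h /\
    forall n, t (quot_proj root_relations (X n)) = z n.
Proof.
move=> zE.
have [e [eC eX]] := malg_lift (h : {rmorphism R -> E}) z.
have [|g gE] := @quot_lift _ root_relations _ e.
  by move=> _ [n _ <-]; rewrite rmorphB rmorphXn eX eC zE subrr.
have gC c : g (quot_proj root_relations c%:MP) = h c by rewrite gE eC.
have gP c : g (alg_map adjoin_roots c) = alg_map E c.
  by rewrite -(alg_funP h) -gC.
exists (AlgHom gP); split; first by apply: alg_hom_ext => c /=; rewrite gC.
by move=> n /=; rewrite gE eX.
Qed.

Lemma adjoin_roots_hom_ext (E : algebra k) (t t' : alg_hom adjoin_roots E) :
  alg_comp t adjoin_inj = alg_comp t' adjoin_inj ->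
  (forall n, t (quot_proj root_relations (X n)) =
             t' (quot_proj root_relations (X n))) ->
  t = t'.
Proof.
move=> tC tX; apply: alg_hom_ext; apply: presented_hom_ext tX => c.
by have /(congr1 (fun u : alg_hom C E => u c)) := tC.
Qed.

End NonzeroBase.

Lemma frobenius_fiber_product (R : comNzRingType) (a : {rmorphism k -> R})
    (y : G (@Algebra k R a)) :
  exists b : F (adjoin_roots a (w y)),
    is_fiber_product f y b (adjoin_inj a (w y)).
Proof.
set C := @Algebra k R a in y *; set D := adjoin_roots a (w y).
have [xV xK xVK] := x_bij D.
pose X n : D := quot_proj (root_relations (w y)) (mvar R n).
pose b := xV X; have bE n : x b n = X n by rewrite xVK.
exists b; split.
  apply: w_inj; apply: funext => n.
  by rewrite fE bE w_nat; apply: adjoin_rootE.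
move=> E b' h' b'E.
have [|t [tC tX]] := @adjoin_roots_lift R a (w y) E h' (x b').
  by move=> n; rewrite -fE b'E w_nat.
exists t; split=> [|t' [t'b t'C]].
  split=> //; apply: (bij_inj (x_bij E)); apply: funext => n.
  by rewrite x_nat bE tX.
apply: adjoin_roots_hom_ext => [|n]; first by rewrite tC t'C.
by rewrite tX -t'b x_nat bE.
Qed.

(** A zero algebra [C] is its own fibre product, with empty spectrum; otherwise
    the fibre product is the spectrum of [adjoin_roots]. *)
Lemma frobenius_universal_homeomorphism : universal_homeomorphism f.
Proof.
move=> C y; have [C0|/eqP C1] := eqVneq (1 : C) 0.
  have A0 (B : algebra k) (h : alg_hom C B) (b b' : B) : b = b'.
    by rewrite -[b]mul1r -[b']mul1r -(rmorph1 h) C0 rmorph0 !mul0r.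
  have [xV xK xVK] := x_bij C.
  exists C, (xV (fun=> 0)), (alg_id C); split.
    split=> [|E x' h' _].
      by apply: w_inj; apply: funext => n; apply: (A0 C (alg_id C)).
    exists h'; split=> [|t [_ <-]]; last by apply: alg_hom_ext.
    split; last by apply: alg_hom_ext.
    by apply: (bij_inj (x_bij E)); apply: funext => n; apply: (A0 E h').
  have noP (P : prime_spectrum C) : False.
    by have [[P0 _ _] P1 _] := prime_setP P; apply: P1; rewrite C0.
  by exists id; split=> P; case: (noP P).
case: C y C1 => R a y R1.
have [R' RR'] := @nonzero_comNzRing R (introN eqP R1).
case: _ / (esym RR') a y {R1} => a y.
have [b bP] := @frobenius_fiber_product R' a y.
exists (adjoin_roots a (w y)), b, (adjoin_inj a (w y)); split=> //.
apply: (purely_inseparable_homeomorphism p_prime (algebra_p0 _)).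
  exact: adjoin_roots_radical.
exact: adjoin_inj_nil.
Qed.

End FrobeniusOnCoordinates.

(** * Congruences for the polynomials of Drinfeld's map *)

Section Congruences.
Variables (A : comPzRingType) (a c : A) (q : nat).
Hypothesis qE : q%:R = a * c.

(** [x^q - y^q] is [x - y] times a sum of [q] monomials, each congruent to
    [y^(q-1)] modulo [a]; that sum is then congruent to [q y^(q-1)], hence to
    [0], modulo [a]. *)
Lemma congr_expq m (x y t : A) :
  x = y + a ^+ m.+1 * t -> exists t', x ^+ q = y ^+ q + a ^+ m.+2 * t'.
Proof.
move=> xE; have xyE : x - y = a * (a ^+ m * t).
  by rewrite xE addrC addKr mulrA -exprS.
pose s := \sum_(i < q) x ^+ (q.-1 - i) * y ^+ i.
have [u uE] : exists u, s = a * u.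
  have sB : s - y ^+ q.-1 *+ q =
      \sum_(i < q) (x ^+ (q.-1 - i) - y ^+ (q.-1 - i)) * y ^+ i.
    rewrite -{2}[q]card_ord -sumr_const -sumrB; apply: eq_bigr => i _.
    by rewrite mulrBl -exprD subnK // -ltnS (ltn_predK (ltn_ord i)).
  exists (\sum_(i < q) a ^+ m * t *
      (\sum_(l < q.-1 - i) x ^+ ((q.-1 - i).-1 - l) * y ^+ l) * y ^+ i +
      c * y ^+ q.-1).
  rewrite mulrDr mulrA -qE mulr_natl -[LHS](subrK (y ^+ q.-1 *+ q)) sB.
  congr (_ + _); rewrite mulr_sumr; apply: eq_bigr => i _.
  by rewrite subrXX xyE !mulrA.
exists (t * u); rewrite -[LHS](subrK (y ^+ q)) subrXX -/s uE xyE addrC.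
by rewrite mulrACA !exprS -!mulrA.
Qed.

Lemma congr_expq_iter (x y t : A) k :
  x = y + a * t -> exists t', x ^+ (q ^ k) = y ^+ (q ^ k) + a ^+ k.+1 * t'.
Proof.
move=> xE; elim: k => [|k [u uE]]; first by exists t; rewrite !expr1.
by have [v vE] := congr_expq uE; exists v; rewrite expnSr !exprM.
Qed.

End Congruences.

Section PowerSubstitution.
Variables (R : comNzRingType) (I : choiceType) (e : I -> nat).
Hypothesis e_gt0 : forall i, (0 < e i)%N.
Local Notation RX := {malg R[{cmonom I}]}.
Variable psi : {rmorphism RX -> RX}.
Hypothesis psiC : forall c, psi c%:MP = c%:MP.
Hypothesis psiX : forall i, psi (mvar R i) = mvar R i ^+ e i.

(** The effect on monomials of raising each variable to the power [e]. *)
Definition cmscale (m : {cmonom I}) : {cmonom I} :=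
  [cmonom m i * e i | i in finsupp m]%M.

Lemma cmscaleE m i : cmscale m i = (m i * e i)%N.
Proof. by rewrite cmE fsfun_fun; case: finsuppP. Qed.

Lemma cmscale_inj : injective cmscale.
Proof.
move=> m n /eqP/cmP mn; apply/eqP/cmP => i.
by apply/eqP; rewrite -(eqn_pmul2r (e_gt0 i)) -!cmscaleE mn.
Qed.

Lemma psi_monomial m : psi << m >> = << cmscale m >>.
Proof.
rewrite !monomial_prod rmorph_prod.
have -> : finsupp (cmscale m) = finsupp m.
  apply/fsetP => i; rewrite -!cmE_neq0 cmscaleE muln_eq0 negb_or.
  by rewrite -(lt0n (e i)) e_gt0 andbT.
by apply: eq_bigr => i _; rewrite rmorphXn psiX cmscaleE -exprM mulnC.
Qed.

Lemma mulr_malgC a c (m : {cmonom I}) :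
  a%:MP * << c *g m >> = << a * c *g m >> :> RX.
Proof. by rewrite [LHS]fgmulUU mul1m. Qed.

Lemma psiE g : psi g = \sum_(m <- msupp g) << g@_m *g cmscale m >>.
Proof.
rewrite {1}[g]monalgE rmorph_sum; apply: eq_bigr => m _.
have -> : << g@_m *g m >> = (g@_m)%:MP * << m >>.
  by rewrite mulr_malgC mulr1.
rewrite rmorphM; transitivity ((g@_m)%:MP * << cmscale m >> : RX).
  by congr (_ * _); [apply: psiC|apply: psi_monomial].
by rewrite mulr_malgC mulr1.
Qed.

Lemma mcoeff_psi g m : (psi g)@_(cmscale m) = g@_m.
Proof.
rewrite psiE raddf_sum /=.
under eq_bigr => l _ do rewrite mcoeffU (inj_eq cmscale_inj).
have [mg|mg] := boolP (m \in msupp g); last first.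
  rewrite (mcoeff_outdom mg) big1_seq // => l /= lg.
  by case: eqP mg => // <-; rewrite lg.
rewrite (big_fsetD1 m) //= eqxx mulr1n big1_seq ?addr0 // => l /=.
by rewrite in_fsetD1 => /andP[/negbTE lm _]; rewrite lm mulr0n.
Qed.

(** Divisibility by a constant is seen on coefficients, and those of [g] are all
    coefficients of [psi g]. *)
Lemma psi_dvdC a f g : psi g = a%:MP * f -> exists g', g = a%:MP * g'.
Proof.
move=> gf; exists (\sum_(m <- msupp g) << f@_(cmscale m) *g m >>).
rewrite mulr_sumr {1}[g]monalgE; apply: eq_bigr => m _.
by rewrite mulr_malgC -mcoeffCM -gf mcoeff_psi.
Qed.

End PowerSubstitution.

Lemma malgC_mulI (R : idomainType) (I : choiceType) (a : R) :
  a != 0 -> injective (fun f : {malg R[{cmonom I}]} => a%:MP * f).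
Proof.
move=> a0 f g fg; apply/malgP => m; apply: (mulfI a0).
by rewrite -!mcoeffCM fg.
Qed.

(** The computation takes place in [O'[X_0, X_1, ...]], with [w = pi'] and
    [d w = pi].  Only formal properties of that ring enter: [psi] substitutes
    [X_i^(q^(i(r-1)))] for [X_i], and [rho n] kills [X_i] for [i >= n], so that
    the elements fixed by [rho n] are the polynomials in the first [n]
    variables. *)
Section DrinfeldPolynomials.
Variables (A : comPzRingType) (w d c : A) (X : nat -> A) (q r : nat).
Variables (psi : {rmorphism A -> A}) (rho : nat -> {rmorphism A -> A}).
Hypothesis r_gt0 : (0 < r)%N.
Hypothesis qE : q%:R = w * c.
Hypothesis w_reg : injective ( *%R w).
Hypotheses (psiw : psi w = w) (psid : psi d = d).
Hypothesis psiX : forall i, psi (X i) = X i ^+ (q ^ (i * r.-1)).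
Hypothesis psi_dvd : forall k f g, psi g = w ^+ k * f ->
  exists g', g = w ^+ k * g'.
Hypotheses (rhow : forall n, rho n w = w) (rhod : forall n, rho n d = d).
Hypothesis rhoX : forall n i, rho n (X i) = if (i < n)%N then X i else 0.
Hypothesis rhoK : forall n i f, (i <= n)%N -> rho i f = f -> rho n f = f.
Variable U : nat -> A.
Hypothesis U_ghost : forall n,
  \sum_(i < n.+1) w ^+ i * U i ^+ ((q ^ r) ^ (n - i)) =
  \sum_(i < (n * r).+1) (d * w) ^+ i * X i ^+ (q ^ (n * r - i)).

(** By induction, [U i = psi (al i)] modulo [w] for [i < n]; so their
    [(q^r)^(n-i)] powers agree modulo [w^(r(n-i)+1)], hence modulo
    [w^(n-i+1)].  Up to a multiple of [w^(n+1)] the ghost identity becomes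
    [w^n U_n = psi G + w^n psi (d^n X_n)] with [G] a polynomial in the first [n]
    variables.  Then [w^n] divides [psi G], hence [G]. *)
Lemma drinfeld_polynomial n : exists g t,
  rho n g = g /\ U n = psi (d ^+ n * X n + g) + w * t.
Proof.
have wI k : injective ( *%R (w ^+ k)).
  elim: k => [|k IH] f g; first by rewrite !mul1r.
  by rewrite exprSr -!mulrA => /IH/w_reg.
elim/ltn_ind: n => n IH.
have /choice[al alP] : forall i, exists al, (i < n)%N ->
    rho n al = al /\ exists t, U i = psi al + w * t.
  move=> i; have [lt_in|] := ltnP i n; last by exists 0.
  have [g [t [gE UE]]] := IH i lt_in.
  exists (d ^+ i * X i + g) => _; split; last by exists t.
  rewrite rmorphD (rhoK (ltnW lt_in) gE) rmorphM rmorphXn rhod rhoX.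
  by rewrite lt_in.
have /choice[T TP] : forall i, exists t, (i < n)%N ->
    w ^+ i * U i ^+ ((q ^ r) ^ (n - i)) =
    psi (w ^+ i * al i ^+ ((q ^ r) ^ (n - i))) + w ^+ n.+1 * t.
  move=> i; have [lt_in|] := ltnP i n; last by exists 0.
  have [_ [t UE]] := alP i lt_in.
  have [t' tE'] := congr_expq_iter qE (r * (n - i)) UE.
  exists (w ^+ (r * (n - i) - (n - i)) * t') => _.
  rewrite -expnM tE' mulrDr rmorphM !rmorphXn psiw; congr (_ + _).
  rewrite !mulrA -!exprD; congr (w ^+ _ * _).
  rewrite addSn addnS; congr _.+1.
  have le_r : (n - i <= r * (n - i))%N by apply: leq_pmull.
  by move: le_r lt_in; move: (r * (n - i))%N => m; lia.
pose G := \sum_(i < n) ((d * w) ^+ i * X i ^+ (q ^ (r * (n - i))) -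
                        w ^+ i * al i ^+ ((q ^ r) ^ (n - i))).
have [t UE] : exists t, w ^+ n * U n =
    psi G + w ^+ n * psi (d ^+ n * X n) + w ^+ n.+1 * t.
  have le_nr : (n <= n * r)%N by apply: leq_pmulr.
  have := U_ghost n.
  rewrite big_ord_recr /= subnn expn0 expr1.
  rewrite -(big_mkord xpredT
    (fun i => (d * w) ^+ i * X i ^+ (q ^ (n * r - i)))).
  rewrite (big_cat_nat (n := n)) //=; last exact: leqW.
  rewrite (@big_ltn _ _ _ n) // big_mkord.
  set tail := \sum_(n.+1 <= i < _) _ => UE.
  have [t tE] : exists t, tail = w ^+ n.+1 * t.
    exists (\sum_(n.+1 <= i < (n * r).+1)
      w ^+ (i - n.+1) * (d ^+ i * X i ^+ (q ^ (n * r - i)))).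
    rewrite /tail mulr_sumr; apply: eq_big_nat => i /andP[lt_ni _].
    by rewrite mulrA -exprD subnKC // exprMn -!mulrA mulrCA.
  exists (t - \sum_(i < n) T i).
  have -> : psi G = \sum_(i < n) (d * w) ^+ i * X i ^+ (q ^ (n * r - i)) -
      \sum_(i < n) psi (w ^+ i * al i ^+ ((q ^ r) ^ (n - i))).
    rewrite /G rmorph_sum -sumrB; apply: eq_bigr => i _.
    rewrite rmorphB; congr (_ - _); rewrite rmorphM !rmorphXn rmorphM psid psiw.
    rewrite psiX -exprM -expnD; congr (_ * _ ^+ (q ^ _)%N).
    have le_in := ltnW (ltn_ord i); have := mulnBr r n i.
    have := mulnS i r.-1; rewrite (prednK r_gt0) (mulnC i r) (mulnC n r).
    have : (r * i <= r * n)%N by rewrite leq_mul2l le_in orbT.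
    have : (i <= r * i)%N by apply: leq_pmull.
    by lia.
  have eqn : (n * r - n = n * r.-1)%N.
    by rewrite -{1}(prednK r_gt0) mulnS addnC addnK.
  have psiXn : w ^+ n * psi (d ^+ n * X n) =
      (d * w) ^+ n * X n ^+ (q ^ (n * r - n)).
    by rewrite rmorphM rmorphXn psid psiX eqn exprMn mulrCA mulrA.
  have UT : \sum_(i < n) w ^+ i * U i ^+ ((q ^ r) ^ (n - i)) =
      \sum_(i < n) psi (w ^+ i * al i ^+ ((q ^ r) ^ (n - i))) +
      w ^+ n.+1 * \sum_(i < n) T i.
    by rewrite mulr_sumr -big_split; apply: eq_bigr => i _; apply: TP.
  move: UE; rewrite UT tE psiXn mulrBr => UE.
  have solve (a b x y z v : A) : a + b + v = x + (y + z) ->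
      v = x - a + y + (z - b).
    move=> vE; apply: (addrI (a + b)); rewrite vE [RHS]addrACA (addrC b) subrK.
    by rewrite (addrA a) (addrC a) subrK addrA.
  exact: solve.
have UE' : psi G = w ^+ n * (U n - psi (d ^+ n * X n) - w * t).
  by rewrite !mulrBr UE mulrA -exprSr addrAC addrK addrK.
have [g gE] := psi_dvd UE'.
exists g, t; split.
  apply: (wI n); rewrite /= -gE -[in LHS](rhow n) -rmorphXn -rmorphM -gE.
  rewrite /G rmorph_sum; apply: eq_bigr => i _.
  have [rho_al _] := alP i (ltn_ord i).
  rewrite rmorphB !rmorphM !rmorphXn rmorphM rhod rhow rhoX ltn_ord.
  by rewrite rho_al.
apply: (wI n); rewrite /= UE gE rmorphM rmorphXn psiw rmorphD.
by rewrite exprSr !mulrDr mulrA [X in X + _]addrC.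
Qed.

End DrinfeldPolynomials.

(** * Drinfeld's map on the special fibre *)

Section WittCoordinates.
Variables (O : comPzRingType) (pi : O) (q : nat) (W : witt_scheme pi q).

Lemma witt_coord_inj (B : algebra O) : injective (@witt_coord _ _ _ W B).
Proof. exact: bij_inj (witt_coord_bij W B). Qed.

Lemma witt_coord_surj (B : algebra O) (v : nat -> B) :
  exists b : W B, witt_coord b = v.
Proof. by case: (witt_coord_bij W B) => f _ fK; exists (f v). Qed.

Lemma witt_coord_ext (B : algebra O) (a b : W B) :
  (forall n, witt_coord a n = witt_coord b n) -> a = b.
Proof. by move=> ab; apply: witt_coord_inj; apply: funext. Qed.

End WittCoordinates.

Lemma malg_alg_lift (k : comNzRingType) (I : choiceType) (B : algebra k)
    (v : I -> B) :
  exists h : alg_hom (@Algebra k {malg k[{cmonom I}]} (@malgC _ k)) B,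
    forall i, h (mvar k i) = v i.
Proof.
have [h [hC hX]] := malg_lift (alg_map B) v.
by exists (AlgHom (A := Algebra (@malgC _ k)) hC).
Qed.

(** In a triangular system the unknowns are determined one after the other. *)
Section Triangular.
Variables (B : Type) (b0 : B) (F : (nat -> B) -> nat -> B).
Hypothesis F_triangular : forall n z z',
  (forall i, (i < n)%N -> z i = z' i) -> F z n = F z' n.

Lemma triangular_fixpoint : exists z, forall n, z n = F z n.
Proof.
(* Z n is correct below n; b0 fills the other places *)
pose step n (z : nat -> B) i := if (i == n) then F z n else z i.
pose fix Z n : nat -> B := if n is m.+1 then step m (Z m) else fun=> b0.
have ZE n i : (i < n)%N -> Z n i = Z i.+1 i.
  elim: n => // n IH; rewrite ltnS leq_eqVlt => /predU1P[->//|lt_in].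
  by rewrite [LHS]/= /step (ltn_eqF lt_in) IH.
exists (fun n => Z n.+1 n) => n; rewrite [LHS]/= /step eqxx.
by apply: F_triangular => i; apply: ZE.
Qed.

Lemma triangular_fixpoint_uniq z z' :
  (forall n, z n = F z n) -> (forall n, z' n = F z' n) -> z = z'.
Proof.
move=> zF z'F; apply: funext => n; elim/ltn_ind: n => n IH.
by rewrite zF z'F; apply: F_triangular.
Qed.

End Triangular.

Section DrinfeldSpecialFiber.
Variables (O O' : idomainType) (kappa' : fieldType).
Variables (pi : O) (pi' d c : O') (q r : nat).
Variables (iota : {rmorphism O -> O'}) (res' : {rmorphism O' -> kappa'}).
Variables (W : witt_scheme pi q) (W' : witt_scheme pi' (q ^ r)).
Variable u : ring_morphism (base_change iota W) W'.
Hypotheses (q_gt0 : (0 < q)%N) (r_gt0 : (0 < r)%N).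
Hypotheses (pi'0 : pi' != 0) (piE : iota pi = d * pi').
Hypothesis qE : q%:R = pi' * c.
Hypotheses (res_pi' : res' pi' = 0) (res_d : res' d != 0).
Hypothesis u_drinfeld : is_drinfeld u.

Local Notation e i := (q ^ (i * r.-1))%N.
Local Notation RX := {malg O'[{cmonom nat}]}.

(** [u] read on the points of [W] over the restricted algebra, which are by
    definition those of the base change. *)
Let act (B : algebra O') (b : W (restrict iota B)) : W' B := u B b.

Let act_ghost (B : algebra O') (b : W (restrict iota B)) (x : nat -> B) n :
  witt_coord b = x ->
  \sum_(i < n.+1) alg_map B pi' ^+ i *
      witt_coord (act b) i ^+ ((q ^ r) ^ (n - i)) =
  \sum_(i < (n * r).+1) (alg_map B d * alg_map B pi') ^+ i *
      x i ^+ (q ^ (n * r - i)).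
Proof.
by move=> <-; rewrite -rmorphM -piE; apply: (u_drinfeld n b).
Qed.

Let act_natural (A B : algebra O') (h : alg_hom A B)
    (b : W (restrict iota A)) n :
  witt_coord (act (rpush W (restrict_hom iota h) b)) n =
  h (witt_coord (act b) n).
Proof.
by rewrite -witt_push_coord; congr (witt_coord _ n); apply: rmor_natural.
Qed.

(** Yoneda: Drinfeld's map is given on coordinates by its value [U] at the Witt
    vector with coordinates the variables, and there the algebra of polynomials
    over the domain [O'] satisfies all that [drinfeld_polynomial] asks for. *)
Lemma universal_drinfeld : exists (U : nat -> RX) (g t : nat -> RX)
    (psi : {rmorphism RX -> RX}) (rho : nat -> {rmorphism RX -> RX}),
  [/\ forall (B : algebra O') (b : W (restrict iota B))
        (h : alg_hom (poly_alg O') B),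
        (forall i, h (mvar O' i) = witt_coord b i) ->
        forall n, witt_coord (u B b) n = h (U n),
      (forall a, psi a%:MP = a%:MP) /\
      (forall i, psi (mvar O' i) = mvar O' i ^+ e i),
      (forall n a, rho n a%:MP = a%:MP) /\
      (forall n i, rho n (mvar O' i) = if (i < n)%N then mvar O' i else 0),
      forall n, rho n (g n) = g n
    & forall n, U n = psi (d%:MP ^+ n * mvar O' n + g n) + pi'%:MP * t n].
Proof.
pose B0 := poly_alg O'.
have [b0 b0E] :=
  @witt_coord_surj _ _ _ W (restrict iota B0) (mvar O' (I := nat)).
pose U n : RX := witt_coord (act b0) n.
have [psi [psiC psiX]] := malg_lift (@malgC {cmonom nat} O')
  (fun i : nat => mvar O' i ^+ e i).
have /choice[rho rhoP] n := malg_lift (@malgC {cmonom nat} O')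
  (fun i : nat => if (i < n)%N then mvar O' i else 0).
have rhoC n : forall a, rho n a%:MP = a%:MP by case: (rhoP n).
have rhoX n : forall i, rho n (mvar O' i) = if (i < n)%N then mvar O' i else 0.
  by case: (rhoP n).
have wE k : pi'%:MP ^+ k = (pi' ^+ k)%:MP :> RX by rewrite rmorphXn.
have U_ghost n : \sum_(i < n.+1) pi'%:MP ^+ i * U i ^+ ((q ^ r) ^ (n - i)) =
  \sum_(i < (n * r).+1) (d%:MP * pi'%:MP) ^+ i *
     mvar O' (i : nat) ^+ (q ^ (n * r - i)) :> RX.
  exact: (act_ghost n b0E).
have /choice[g gP] n : exists g t : RX, rho n g = g /\
    U n = psi (d%:MP ^+ n * mvar O' n + g) + pi'%:MP * t.
  have qE' : q%:R = pi'%:MP * c%:MP :> RX.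
    by rewrite -(rmorphM (@malgC {cmonom nat} O')) -qE rmorph_nat.
  have dvd k h f : psi f = pi'%:MP ^+ k * h ->
      exists f', f = pi'%:MP ^+ k * f' :> RX.
    rewrite wE; apply: (psi_dvdC _ psiC psiX) => i.
    by rewrite expn_gt0 q_gt0.
  have rhoK m i f : (i <= m)%N -> rho i f = f -> rho m f = f.
    move=> le_im fE; rewrite -fE.
    apply: (@malg_hom_ext _ _ _ (rho m \o rho i) (rho i)) => [a|l] /=.
      by rewrite !rhoC.
    rewrite !rhoX; case: ifP => li; last by rewrite rmorph0.
    by rewrite rhoX (leq_trans li le_im).
  have reg : injective ( *%R (pi'%:MP : RX)) by exact: malgC_mulI.
  exact: (drinfeld_polynomial r_gt0 qE' reg (psiC pi') (psiC d) psiX dvd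
    (fun m => rhoC m pi') (fun m => rhoC m d) rhoX rhoK U_ghost).
have /choice[t tP] := gP.
exists U, g, t, psi, rho; split=> //; try by move=> n; case: (tP n).
move=> B b h hb n.
have -> : b = rpush W (restrict_hom iota h) b0.
  apply: witt_coord_ext => i; rewrite witt_push_coord /= b0E.
  by rewrite -hb.
exact: act_natural.
Qed.

(** The new coordinates are [w = V^-1], where [V] ([tau] below) is the reduction
    of the triangular polynomials [d^n Y_n + g_n]; it is invertible because [d]
    stays a unit in [kappa'] and [g_n] only involves the first [n] variables. *)
Theorem drinfeld_special_fiber :
  let u_s := base_change_mor res' u in
  exists w : forall B : algebra kappa',
      base_change res' W' B -> nat -> B,
    [/\ natural_coords (F := ring_kfunctor (base_change res' W')) w,
        forall B, injective (w B)
      & forall B (b : base_change res' (base_change iota W) B) n,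
          w B (u_s B b) n =
          witt_coord (b : W (restrict iota (restrict res' B))) n ^+ e n].
Proof.
move=> u_s.
have [U [g [t [psi [rho [UP [psiC psiX] [rhoC rhoX] rho_g UE]]]]]] :=
  universal_drinfeld.
have lift (B : algebra kappa') (z : nat -> B) :=
  malg_lift (alg_map B \o res' : {rmorphism O' -> B}) z.
pose ev (B : algebra kappa') z : {rmorphism RX -> B} := sval (cid (lift B z)).
have evC B z a : ev B z a%:MP = alg_map B (res' a).
  by rewrite /ev; case: cid => h [hC hX] /=; rewrite hC.
have evX B z i : ev B z (mvar O' i) = z i.
  by rewrite /ev; case: cid => h [hC hX] /=; rewrite hX.
clearbody ev.
pose delta (B : algebra kappa') := alg_map B (res' d).
pose delta' (B : algebra kappa') := alg_map B (res' d)^-1.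
have deltaK B : delta' B * delta B = 1.
  by rewrite /delta /delta' -rmorphM mulVf // rmorph1.
pose tau (B : algebra kappa') (z : nat -> B) n :=
  delta B ^+ n * z n + ev B z (g n).
have ev_g B n z z' : (forall i, (i < n)%N -> z i = z' i) ->
    ev B z (g n) = ev B z' (g n).
  move=> zz'; rewrite -rho_g.
  apply: (@malg_hom_ext _ _ _ (ev B z \o rho n) (ev B z' \o rho n)) => [a|i] /=.
    by rewrite rhoC !evC.
  rewrite rhoX; case: ifP => [lt_in|_]; last by rewrite !rmorph0.
  by rewrite !evX zz'.
have u_tau B (b : base_change res' (base_change iota W) B) n :
    witt_coord (u_s B b : W' (restrict res' B)) n =
    tau B (fun i =>
      witt_coord (b : W (restrict iota (restrict res' B))) i ^+ e i) n.
  set x := fun i => witt_coord b i : B; set z := fun i => _.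
  have hP a : ev B x (alg_map (poly_alg O') a) = alg_map (restrict res' B) a.
    exact: evC.
  pose h := AlgHom (A := poly_alg O') (B := restrict res' B) hP.
  rewrite [LHS](UP (restrict res' B) b h); last by move=> i; apply: evX.
  rewrite [LHS]/= UE rmorphD rmorphM evC res_pi' rmorph0 mul0r addr0.
  have evpsi f : ev B x (psi f) = ev B z f.
    apply: (@malg_hom_ext _ _ _ (ev B x \o psi) (ev B z)) => [a|i] /=.
      by rewrite psiC !evC.
    by rewrite psiX rmorphXn !evX.
  by rewrite evpsi rmorphD rmorphM rmorphXn evC evX.
have ev_nat (A B : algebra kappa') (h : alg_hom A B) z f :
    h (ev A z f) = ev B (h \o z) f.
  apply: (@malg_hom_ext _ _ _ (h \o ev A z) (ev B (h \o z))) => [a|i] /=.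
    by rewrite !evC alg_funP.
  by rewrite !evX.
pose F (B : algebra kappa') (v z : nat -> B) n :=
  delta' B ^+ n * (v n - ev B z (g n)).
have tauE (B : algebra kappa') (v z : nat -> B) :
    tau B z = v <-> forall n, z n = F B v z n.
  have dK n : delta' B ^+ n * delta B ^+ n = 1 by rewrite -exprMn deltaK expr1n.
  split=> [<- n|zE]; first by rewrite /F /tau addrK mulrA dK mul1r.
  apply: funext => n; rewrite /tau {1}zE /F mulrA.
  by rewrite [_ * delta' B ^+ n]mulrC dK mul1r subrK.
have F_triangular (B : algebra kappa') (v : nat -> B) n (z z' : nat -> B) :
    (forall i, (i < n)%N -> z i = z' i) -> F B v z n = F B v z' n.
  by move=> zz'; rewrite /F (ev_g _ _ _ _ zz').
have tau_inj B : injective (tau B).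
  move=> z z' zz'.
  apply: (triangular_fixpoint_uniq (F_triangular B (tau B z'))).
    by apply/tauE.
  exact/tauE.
have tau_surj B v : exists z, tau B z = v.
  have [z zE] := triangular_fixpoint 0 (F_triangular B v).
  by exists z; apply/tauE.
pose w B (b : base_change res' W' B) : nat -> B :=
  sval (cid (tau_surj B (witt_coord (b : W' (restrict res' B))))).
have wP B b : tau B (w B b) = witt_coord (b : W' (restrict res' B)).
  by rewrite /w; case: cid.
exists w; split=> [A B h a n|B b b' bb'|B b n].
- have tau_h z : tau B (h \o z) = h \o tau A z.
    apply: funext => i; rewrite /tau /= -ev_nat rmorphD rmorphM rmorphXn.
    by rewrite /delta alg_funP.
  suff -> : w B (rpush (base_change res' W') h a) = h \o w A a by [].
  apply: tau_inj; rewrite wP tau_h wP; apply: funext => i.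
  by rewrite [LHS]witt_push_coord.
- by apply: witt_coord_inj; rewrite -!wP bb'.
- suff -> : w B (u_s B b) = fun i =>
    witt_coord (b : W (restrict iota (restrict res' B))) i ^+ e i by [].
  by apply: tau_inj; rewrite wP; apply: funext => i; rewrite u_tau.
Qed.

End DrinfeldSpecialFiber.

(** * Truncation of Witt vectors and of affine space *)

Definition agree (T : Type) (n : nat) (v v' : nat -> T) : Prop :=
  forall i, (i < n)%N -> v i = v' i.

Section WittAddition.
Variables (O : idomainType) (pi : O) (q : nat) (W : witt_scheme pi q).
Hypotheses (pi0 : pi != 0) (q_gt0 : (0 < q)%N).

Lemma ghost_agree (B : algebra O) n (v v' : nat -> B) i :
  agree n v v' -> (i < n)%N -> ghost pi q i v = ghost pi q i v'.
Proof.
move=> vv' lt_in; apply: eq_bigr => l _; rewrite vv' //.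
by apply: leq_ltn_trans lt_in; rewrite -ltnS.
Qed.

(** Without [pi]-torsion the last coordinate can be recovered from a ghost
    component and the previous coordinates. *)
Lemma ghost_determines (B : algebra O) n (v v' : nat -> B) :
  injective ( *%R (alg_map B pi)) ->
  (forall i, (i < n)%N -> ghost pi q i v = ghost pi q i v') -> agree n v v'.
Proof.
move=> piI vv'; elim/ltn_ind => i IH lt_in.
have piI' : injective ( *%R (alg_map B pi ^+ i)).
  elim: {IH lt_in} i => [|i IH] f g; first by rewrite !mul1r.
  by rewrite exprSr -!mulrA => /IH/piI.
have := vv' i lt_in; rewrite /ghost !big_ord_recr /= subnn !expr1.
rewrite (eq_bigr (fun l : 'I_i => alg_map B pi ^+ l * v' l ^+ (q ^ (i - l)))).
  by move=> /addrI/piI'.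
by move=> l _; rewrite IH // (ltn_trans _ lt_in).
Qed.

(** The ghost components of zero vanish, so over the domain [O] its coordinates
    do; any other algebra receives its zero vector from there. *)
Lemma witt_coord0 (B : algebra O) n : witt_coord (0 : W B) n = 0.
Proof.
pose OO := @Algebra O O (idfun : {rmorphism O -> O}).
have z0 : witt_coord (0 : W OO) n = 0.
  apply: (@ghost_determines OO n.+1 _ (fun=> 0)) => [|i _|//].
    exact: mulfI.
  have /eqP := witt_ghostD i (0 : W OO) 0.
  rewrite addr0 -subr_eq0 opprD addrA subrr sub0r oppr_eq0 => /eqP ->.
  rewrite /ghost big1 // => l _.
  by rewrite expr0n expn_eq0 -leqn0 leqNgt q_gt0 mulr0.
pose h := @AlgHom O OO B (alg_map B) (fun=> erefl).
by rewrite -(rmorph0 (rpush W h)) witt_push_coord z0 rmorph0.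
Qed.

(** The polynomial algebra on the set [B]: an element is lifted to its variable,
    so that equal elements have equal lifts. *)
Lemma torsion_free_cover (B : algebra O) :
  exists (L : algebra O) (h : alg_hom L B) (s : B -> L),
    injective ( *%R (alg_map L pi)) /\ forall x, h (s x) = x.
Proof.
have [h hX] := @malg_alg_lift O B B id.
exists (Algebra (@malgC {cmonom B} O)), h, (mvar O (I := B)).
by split; [apply: malgC_mulI|apply: hX].
Qed.

(** Over an algebra without pi-torsion, ghost components determine the
    coordinates and are additive; the general case follows by lifting, the same
    element of [B] being always lifted in the same way. *)
Lemma witt_coordD_agree (B : algebra O) n (a a' b b' : W B) :
  agree n (witt_coord a) (witt_coord a') ->
  agree n (witt_coord b) (witt_coord b') ->
  agree n (witt_coord (a + b)) (witt_coord (a' + b')).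
Proof.
move=> aa' bb'; have [L [h [s [piI hs]]]] := torsion_free_cover B.
have lift (c : W B) : exists l : W L, witt_coord l = s \o witt_coord c.
  exact: witt_coord_surj.
have hl (c : W B) (l : W L) : witt_coord l = s \o witt_coord c ->
    rpush W h l = c.
  by move=> lE; apply: witt_coord_ext => i; rewrite witt_push_coord lE /= hs.
have [[la laE] [la' la'E]] := (lift a, lift a').
have [[lb lbE] [lb' lb'E]] := (lift b, lift b').
rewrite -(hl _ _ laE) -(hl _ _ la'E) -(hl _ _ lbE) -(hl _ _ lb'E) -!rmorphD.
move=> i lt_in; rewrite !witt_push_coord; congr (h _).
apply: (ghost_determines (n := n) piI) lt_in => l lt_ln.
rewrite !witt_ghostD; congr (_ + _); apply: (ghost_agree _ lt_ln) => m lt_mn.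
  by rewrite laE la'E /= aa'.
by rewrite lbE lb'E /= bb'.
Qed.

End WittAddition.

Lemma indetE (k : comNzRingType) i : indet k i = mvar k i.
Proof. by rewrite mvar.unlock. Qed.

Section TruncatedAffineSpace.
Variables (k : comNzRingType) (d : nat -> nat).

Definition power_relations : set (poly_alg k) :=
  [set indet k i ^+ d i | i in [set: nat]].

Definition truncated_alg : algebra k := quot_alg power_relations.

Definition tvar (i : nat) : truncated_alg :=
  quot_proj power_relations (mvar k i).

Lemma tvar_exp i : tvar i ^+ d i = 0.
Proof.
rewrite /tvar -rmorphXn; apply: quot_proj_eq0.
by exists i; [|rewrite indetE].
Qed.

Lemma truncated_alg_lift (B : algebra k) (v : nat -> B) :
  (forall i, v i ^+ d i = 0) ->
  exists h : alg_hom truncated_alg B, forall i, h (tvar i) = v i.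
Proof.
move=> v0; have [h [hC hX]] := malg_lift (alg_map B) v.
have [|g gE] := @quot_lift _ power_relations B h.
  by move=> _ [i _ <-]; rewrite indetE rmorphXn hX.
have gC c : g (alg_map truncated_alg c) = alg_map B c by rewrite gE hC.
by exists (AlgHom gC) => i; rewrite /= gE hX.
Qed.

Lemma truncated_hom_ext (B : algebra k) (h h' : alg_hom truncated_alg B) :
  (forall i, h (tvar i) = h' (tvar i)) -> h = h'.
Proof.
move=> hh'; apply: alg_hom_ext; apply: presented_hom_ext hh' => c.
exact: etrans (alg_funP h c) (esym (alg_funP h' c)).
Qed.

(** A morphism out of a presented algebra is a choice of images of the
    generators that satisfies the relations. *)
Lemma Spec_truncated (F : kfunctor k)
    (x : forall B : algebra k, F B -> nat -> B) :
  natural_coords x -> (forall B, injective (@x B)) ->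
  (forall B b i, x B b i ^+ d i = 0) ->
  (forall B v, (forall i, v i ^+ d i = 0) -> exists b, x B b = v) ->
  isomorphic F (Spec truncated_alg).
Proof.
move=> x_nat x_inj x_nil x_surj.
pose f B (b : F B) : Spec truncated_alg B :=
  sval (cid (truncated_alg_lift (x_nil B b))).
have fE B (b : F B) i : f B b (tvar i) = x B b i by rewrite /f; case: cid.
have f_nat A B (h : alg_hom A B) (a : F A) : f B (push h a) = push h (f A a).
  by apply: truncated_hom_ext => i; rewrite fE x_nat /= fE.
exists (KMorphism f_nat) => B /=.
have /choice[g gE] : forall h : Spec truncated_alg B, exists b : F B,
    x B b = fun i => h (tvar i).
  move=> h; apply: x_surj => i.
  by rewrite -rmorphXn tvar_exp rmorph0.
exists g => [b|h].
  by apply: x_inj; rewrite gE; apply: funext => i; rewrite fE.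
by apply: truncated_hom_ext => i; rewrite fE gE.
Qed.

End TruncatedAffineSpace.

(** * Truncated affine spaces of finite level *)

Lemma ideal_mulB (R : comPzRingType) (J : set R) (y z b c : R) :
  is_ideal J -> J (y - b) -> J (z - c) -> J (y * z - b * c).
Proof.
move=> [_ JD JM] yb zc; have -> : y * z - b * c = y * (z - c) + c * (y - b).
  by rewrite !mulrBr (mulrC c y) addrA subrK (mulrC c).
by apply: JD; apply: JM.
Qed.

Section Span.
Variables (k : comPzRingType) (A : algebra k) (T : finType) (e : T -> A).

Definition in_span (a : A) : Prop :=
  exists c : 'I_#|T| -> k, a = \sum_i alg_map A (c i) * e (enum_val i).

Lemma in_span0 : in_span 0.
Proof.
by exists (fun=> 0); rewrite big1 // => i _; rewrite rmorph0 mul0r.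
Qed.

Lemma in_spanD a b : in_span a -> in_span b -> in_span (a + b).
Proof.
move=> [c ->] [c' ->]; exists (fun i => c i + c' i).
by rewrite -big_split; apply: eq_bigr => i _; rewrite rmorphD mulrDl.
Qed.

Lemma in_spanZ z a : in_span a -> in_span (alg_map A z * a).
Proof.
move=> [c ->]; exists (fun i => z * c i).
by rewrite mulr_sumr; apply: eq_bigr => i _; rewrite rmorphM mulrA.
Qed.

Lemma in_span_gen f : in_span (e f).
Proof.
exists (fun i => (i == enum_rank f)%:R).
rewrite (bigD1 (enum_rank f)) //= eqxx rmorph1 mul1r enum_rankK.
by rewrite big1 ?addr0 // => i /negbTE ->; rewrite rmorph0 mul0r.
Qed.

End Span.

Section FiniteTruncation.
Variables (k : fieldType) (d : nat -> nat) (n : nat).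
Hypotheses (d_gt0 : forall i, (0 < d i)%N).
Local Notation Q := (truncated_alg k d).
Local Notation x := (tvar k d).

Lemma tvar_exp_ge i m : (d i <= m)%N -> x i ^+ m = 0.
Proof. by move=> /subnK <-; rewrite exprD tvar_exp mulr0. Qed.

(** Such a morphism is the evaluation at the origin. *)
Definition augmented (e : alg_hom Q (@Algebra k k idfun)) :=
  forall i, e (x i) = 0.

Lemma augmentation_exists : exists e, augmented e.
Proof.
apply: truncated_alg_lift (fun=> 0) _ => i /=.
by rewrite expr0n -leqn0 leqNgt d_gt0.
Qed.

(** A prime contains the nilpotent variables, so modulo it any element is its
    constant term [e a]; a nonzero constant is a unit. *)
Lemma truncated_prime (P : prime_spectrum Q) e (a : Q) :
  augmented e -> prime_set P a <-> e a = 0.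
Proof.
move=> eX; have [idP P1 _] := prime_setP P; have [P0 PD PM] := idP.
have PB : prime_set P (a - alg_map Q (e a)).
  case: (quot_projP a) => f <- {a}; elim/malg_ind: f => [c|i|f g|f g].
  - have -> : quot_proj _ c%:MP = alg_map Q c by [].
    by rewrite alg_funP subrr.
  - rewrite -[quot_proj _ _]/(x i) eX rmorph0 subr0.
    by apply: (@prime_expr _ _ (d i)); rewrite tvar_exp.
  - by rewrite !rmorphD opprD addrACA; apply: PD.
  - rewrite !rmorphM => Pf Pg.
    exact: (ideal_mulB idP Pf Pg).
split=> [Pa|ea]; last by move: PB; rewrite ea rmorph0 subr0.
apply: contra_notP P1 => /eqP ea.
have Pe : prime_set P (alg_map Q (e a)).
  rewrite -[X in prime_set P X](subrK a) -opprB -mulN1r.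
  by apply: PD => //; apply: PM.
by rewrite -(rmorph1 (alg_map Q)) -(mulVf ea) rmorphM; apply: PM.
Qed.

Lemma truncated_one_point :
  exists P : prime_spectrum Q, forall P', P' = P.
Proof.
have [e eX] := augmentation_exists.
have z_prime : is_prime_ideal ([set 0] : set k).
  split=> [|/eqP|a b /eqP]; rewrite ?oner_eq0 //=.
    by split=> [//|a b /= -> ->|a b /= ->]; rewrite ?addr0 ?mulr0.
  by rewrite mulf_eq0 => /orP[] /eqP; [left|right].
exists (spec_map e (PrimeIdeal z_prime)) => P'.
by apply: spectrum_ext => a; rewrite !(truncated_prime _ _ eX).
Qed.

(* d i = 1 says that the i-th variable vanishes *)
Hypothesis d1 : forall i, (n <= i)%N -> d i = 1%N.

(** A monomial vanishes unless all its exponents are below the bounds [d], and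
    in that case it only involves the first [n] variables. *)
Lemma tmonomial_support (m : {cmonom nat}) :
  \prod_(i <- finsupp m) x i ^+ m i = 0 \/
  (forall i, m i < d i)%N /\
  \prod_(i <- finsupp m) x i ^+ m i = \prod_(i < n) x i ^+ m i.
Proof.
have [lt_md|/existsNP[i /negP]] := pselect (forall i, (m i < d i)%N);
  last first.
  rewrite -leqNgt => le_dm; left.
  have im : i \in finsupp m.
    by rewrite -cmE_neq0 -lt0n; apply: leq_trans le_dm.
  by rewrite (big_fsetD1 i) //= tvar_exp_ge // mul0r.
right; split=> //.
rewrite -(big_mkord xpredT (fun i => x i ^+ m i)) /index_iota subn0.
rewrite [RHS](bigID (mem (finsupp m))) /= [X in _ * X]big1; last first.
  by move=> i /fsfun_dflt ->.
rewrite mulr1 -[RHS]big_filter; apply: perm_big; apply: uniq_perm => [||i].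
- exact: fset_uniq.
- by rewrite filter_uniq ?iota_uniq.
- rewrite mem_filter mem_iota add0n /= andb_idr // -cmE_neq0.
  apply: contraR; rewrite -leqNgt => /d1 di; have := lt_md i.
  by rewrite di ltnS leqn0.
Qed.

(** Spanned by the monomials in the first [n] variables with exponents below a
    common bound of the [d i]. *)
Lemma truncated_finite_span : exists (N : nat) (e : 'I_N -> Q), forall a : Q,
  exists c : 'I_N -> k, a = \sum_(i < N) alg_map Q (c i) * e i.
Proof.
pose E := (\sum_(i < n) d i).+1.
pose T := {ffun 'I_n -> 'I_E}.
pose mon (f : T) : Q := \prod_(i < n) x i ^+ f i.
exists #|T|, (mon \o enum_val) => a.
suff: in_span mon a by [].
case: (quot_projP a) => g <-; rewrite [g]monalgE rmorph_sum.
apply: (big_ind (in_span mon)) => [|y z|m _].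
- exact: in_span0.
- exact: in_spanD.

have -> : << g@_m *g m >> = (g@_m)%:MP * << m >> :> {malg k[{cmonom nat}]}.
  by rewrite mulr_malgC mulr1.
rewrite rmorphM; apply: (in_spanZ g@_m); rewrite monomial_prod rmorph_prod.
under eq_bigr => i _ do rewrite rmorphXn -/(x i).
have [->|[lt_md ->]] := tmonomial_support m.
  exact: in_span0.
have -> : \prod_(i < n) x i ^+ m i =
    mon [ffun i : 'I_n => inord (m i) : 'I_E]; last exact: in_span_gen.
apply: eq_bigr => i _; rewrite ffunE inordK // /E ltnS.
apply: ltnW; apply: leq_trans (lt_md i) _.
by rewrite (bigD1 i) //= leq_addr.
Qed.

End FiniteTruncation.

(** * Pro-infinitesimal groups from truncated coordinates *)

Section ProInfinitesimal.
Variables (k : fieldType) (d : nat -> nat) (G : group_functor k).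
Variable x : forall B : algebra k, G B -> nat -> B.
Hypotheses (d_gt0 : forall i, (0 < d i)%N).
Hypotheses (x_nat : natural_coords x) (x_inj : forall B, injective (@x B)).
Hypothesis x_nil : forall B (b : G B) i, x b i ^+ d i = 0.
Hypothesis x_surj : forall (B : algebra k) (v : nat -> B),
  (forall i, v i ^+ d i = 0) -> exists b : G B, x b = v.
Hypothesis x_mul : forall (B : algebra k) n (a a' b b' : G B),
  agree n (x a) (x a') -> agree n (x b) (x b') ->
  agree n (x (gmul a b)) (x (gmul a' b')).

Lemma truncation_exists n (B : algebra k) (a : G B) : exists b : G B,
  x b = fun i => if (i < n)%N then x a i else 0.
Proof.
apply: x_surj => i; case: ifP => _; first exact: x_nil.
by rewrite expr0n -leqn0 leqNgt d_gt0.
Qed.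

Definition trunc n (B : algebra k) (a : G B) : G B :=
  sval (cid (truncation_exists n a)).

Lemma truncE n (B : algebra k) (a : G B) i :
  x (trunc n a) i = if (i < n)%N then x a i else 0.
Proof. by rewrite /trunc; case: cid => b /= ->. Qed.

Section Level.
Variable n : nat.

(** The quotient of [G] at level [n] is modelled on the representatives whose
    coordinates vanish from [n] on, with the operations of [G] followed by
    truncation; these representatives are the points of an affine scheme. *)
Definition level (B : algebra k) : Type :=
  {a : G B | forall i, (n <= i)%N -> x a i = 0}.

Lemma level_ext (B : algebra k) (a b : level B) :
  agree n (x (sval a)) (x (sval b)) -> a = b.
Proof.
case: a b => [a a0] [b b0] /= ab; apply: eq_exist; apply: x_inj.
apply: funext => i; case: (ltnP i n) => [/ab//|le_ni].
by rewrite a0 ?b0.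
Qed.

Lemma trunc_level (B : algebra k) (a : G B) i :
  (n <= i)%N -> x (trunc n a) i = 0.
Proof. by rewrite truncE ltnNge => ->. Qed.

Definition to_level (B : algebra k) (a : G B) : level B :=
  exist _ (trunc n a) (@trunc_level B a).

Lemma level_push_proof (A B : algebra k) (h : alg_hom A B) (a : level A) i :
  (n <= i)%N -> x (push h (sval a)) i = 0.
Proof. by move=> le_ni; rewrite x_nat (svalP a) // rmorph0. Qed.

Definition level_push (A B : algebra k) (h : alg_hom A B) (a : level A) :
  level B := exist _ (push h (sval a)) (@level_push_proof A B h a).

Lemma level_push_id A (a : level A) : level_push (alg_id A) a = a.
Proof. by apply: level_ext => i _; rewrite /= push_id. Qed.

Lemma level_push_comp (A B C : algebra k) (g : alg_hom B C) (f : alg_hom A B)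
  (a : level A) :
  level_push (alg_comp g f) a = level_push g (level_push f a).
Proof. by apply: level_ext => i _; rewrite /= push_comp. Qed.

Definition level_kfunctor : kfunctor k :=
  KFunctor level_push_id level_push_comp.

Definition level_mul (B : algebra k) (a b : level B) : level B :=
  to_level (gmul (sval a) (sval b)).
Definition level_one (B : algebra k) : level B := to_level (gone G B).
Definition level_inv (B : algebra k) (a : level B) : level B :=
  to_level (ginv (sval a)).

(** Truncation is compatible with the operations; as it is also surjective
    ([to_levelK]), the group axioms of [G] carry over to each level. *)
Lemma to_level_mul (B : algebra k) (a b : G B) :
  to_level (gmul a b) = level_mul (to_level a) (to_level b).
Proof.
apply: level_ext => i lt_in; rewrite /= !truncE lt_in.
by apply: x_mul lt_in => l lt_ln; rewrite truncE lt_ln.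
Qed.

Lemma to_levelK (B : algebra k) (a : level B) : to_level (sval a) = a.
Proof. by apply: level_ext => i lt_in; rewrite /= truncE lt_in. Qed.

Lemma level_mulA (B : algebra k) : associative (@level_mul B).
Proof.
move=> a b c; rewrite -[a]to_levelK -[b]to_levelK -[c]to_levelK.
by rewrite -!to_level_mul gmulA.
Qed.

Lemma level_mul1 (B : algebra k) : left_id (level_one B) (@level_mul B).
Proof. by move=> a; rewrite -[a]to_levelK -to_level_mul gmul1. Qed.

Lemma level_mulV (B : algebra k) :
  left_inverse (level_one B) (@level_inv B) (@level_mul B).
Proof.
move=> a; rewrite -[X in level_mul _ X]to_levelK -to_level_mul.
by rewrite gmulV.
Qed.

Lemma to_level_push (A B : algebra k) (h : alg_hom A B) (a : G A) :
  to_level (push h a) = level_push h (to_level a).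
Proof.
apply: level_ext => i lt_in; rewrite /= truncE lt_in !x_nat.
by rewrite truncE lt_in.
Qed.

Lemma level_push_mul (A B : algebra k) (h : alg_hom A B) (a b : level A) :
  level_push h (level_mul a b) = level_mul (level_push h a) (level_push h b).
Proof.
rewrite -to_level_push push_gmul to_level_mul.
by rewrite !to_level_push !to_levelK.
Qed.

Definition level_group : group_functor k :=
  @GroupFunctor k level_kfunctor level_mul level_one level_inv
    level_mulA level_mul1 level_mulV level_push_mul.

Definition to_level_kmorphism : kmorphism G level_group :=
  @KMorphism k G level_group to_level to_level_push.

Definition to_level_morphism : group_morphism G level_group :=
  @GroupMorphism k G level_group to_level_kmorphism to_level_mul.

Definition level_exponent i := if (i < n)%N then d i else 1%N.

Lemma level_infinitesimal : infinitesimal level_group.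
Proof.
have gt0 i : (0 < level_exponent i)%N by rewrite /level_exponent; case: ifP.
exists (truncated_alg k level_exponent); split.
- apply: (@Spec_truncated _ _ level_kfunctor (fun B a => x (sval a))).
  + by move=> A B h a i; rewrite /= x_nat.
  + by move=> B a b ab; apply: level_ext => i _; rewrite ab.
  + move=> B b i; rewrite /level_exponent; case: ltnP => [_|le_ni].
      exact: x_nil.
    by rewrite expr1; apply: (svalP b).
  + move=> B v v0; have [i|a aE] := @x_surj B v.
      have := v0 i; rewrite /level_exponent; case: ifP => // _.
      by rewrite expr1 => ->; rewrite expr0n -leqn0 leqNgt d_gt0.
    have a0 i : (n <= i)%N -> x a i = 0.
      move=> le_ni; rewrite aE; have := v0 i.
      by rewrite /level_exponent ltnNge le_ni expr1.
    by exists (exist _ a a0).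
- apply: (@truncated_finite_span _ _ n) => [|i le_ni]; first exact: gt0.
  by rewrite /level_exponent ltnNge le_ni.
- exact: truncated_one_point gt0.
Qed.

End Level.

Section Transition.
Variables (i j : nat).

Definition transition (ij : (i <= j)%N) (B : algebra k) (a : level j B) :
  level i B := to_level i (sval a).

Lemma transition_push ij A B (h : alg_hom A B) (a : level j A) :
  transition ij (level_push h a) = level_push h (transition ij a).
Proof. exact: to_level_push. Qed.

Lemma transition_to_level ij (B : algebra k) (a : G B) :
  transition ij (to_level j a) = to_level i a.
Proof.
apply: level_ext => l lt_li; rewrite /= !truncE lt_li.
by rewrite (leq_trans lt_li ij).
Qed.

Lemma transition_mul ij B (a b : level j B) :
  transition ij (level_mul a b) = level_mul (transition ij a) (transition ij b).
Proof. by rewrite [LHS]transition_to_level to_level_mul. Qed.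

Definition transition_kmorphism ij :
    kmorphism (level_group j) (level_group i) :=
  @KMorphism k (level_group j) (level_group i) (transition ij)
    (transition_push ij).

Definition transition_morphism ij :
  group_morphism (level_group j) (level_group i) :=
  @GroupMorphism k (level_group j) (level_group i) (transition_kmorphism ij)
    (transition_mul ij).

End Transition.

(** In a compatible family the [i]-th coordinate is the same at all levels
    beyond [i], and these stable values are the coordinates of the limit. *)
Lemma truncated_coords_pro_infinitesimal : pro_infinitesimal G.
Proof.
split.
  by exists (truncated_alg k d); apply: Spec_truncated x_nat x_inj x_nil x_surj.
exists nat, (fun i j => (i <= j)%N), level_group, transition_morphism,
  to_level_morphism; split.
- split; [by exists 0|exact: leqnn|by move=> i j l; apply: leq_trans|].
  by move=> i j; exists (maxn i j); rewrite leq_maxl leq_maxr.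
- exact: level_infinitesimal.
- by move=> i ii B a; apply: to_levelK.
- move=> i j l ij jl il B a; rewrite -[a]to_levelK /=.
  by rewrite !transition_to_level.
- split=> [i j ij B g|B a aP]; first exact: transition_to_level.
  have aE i j l : (l < i)%N -> (i <= j)%N ->
      x (sval (a j)) l = x (sval (a i)) l.
    by move=> lt_li ij; rewrite -(aP i j ij) /= truncE lt_li.
  have [i|g gE] := @x_surj B (fun i => x (sval (a i.+1)) i); first exact: x_nil.
  exists g; split=> [i|g' g'P].
    apply: level_ext => l lt_li; rewrite /= truncE lt_li gE.
    by rewrite (aE l.+1 i).
  apply: x_inj; apply: funext => i; rewrite gE -(g'P i.+1) /=.
  by rewrite truncE leqnn.
Qed.

End ProInfinitesimal.

(** * The extension and the residue fields *)

(** Each of [iota pi] and [pi'] is a multiple of the other, because the nonunits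
    of [O'] form the ideal generated by [pi'] and also the one generated by the
    image of the nonunits of [O]. *)
Lemma unramified_uniformizers (O O' : idomainType) (iota : {rmorphism O -> O'})
    (pi : O) (pi' : O') :
  is_dvr O -> is_uniformizer pi -> is_uniformizer pi' -> injective iota ->
  is_unramified iota ->
  [/\ pi != 0, pi' != 0
    & exists2 d, iota pi = d * pi' & d \is a GRing.unit].
Proof.
move=> [_ _ [z z0 z_nu]] pi_unif pi'_unif iota_inj unram.
have pi0 : pi != 0.
  apply: contraNneq z0 => pi0; have : nonunits z by [].
  by rewrite pi_unif pi0 => -[b ->]; rewrite mulr0.
have gen_pi (R : idomainType) (a : R) : is_uniformizer a -> nonunits a.
  by move=> ->; exists 1; rewrite mul1r.
have [a pi'E] : principal (iota pi) pi'.
  have : nonunits pi' by exact: gen_pi.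
  rewrite -unram; apply.
    split=> [|x y [b ->] [c ->]|x y [b ->]].
    - by exists 0; rewrite mul0r.
    - by exists (b + c); rewrite mulrDl.
    - by exists (x * b); rewrite mulrA.
  move=> _ [s + <-]; rewrite pi_unif => -[b ->].
  by exists (iota b); rewrite rmorphM.
have [d piE] : principal pi' (iota pi).
  rewrite -pi'_unif -unram => J _; apply.
  by exists pi => //; apply: gen_pi.
have pi'0 : pi' != 0.
  apply: contra_neq pi0 => pi'0; apply: iota_inj.
  by rewrite rmorph0 piE pi'0 mulr0.
split=> //; exists d => //; apply/unitrP; exists a.
have ad : a * d = 1.
  by apply: (mulIf pi'0); rewrite mul1r -mulrA -piE -pi'E.
by split; rewrite // mulrC.
Qed.

Lemma ring_of_integers_inj (O : idomainType) (K' : fieldExtType {fraction O})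
    (O' : idomainType) (j : {rmorphism O' -> K'}) (iota : {rmorphism O -> O'}) :
  is_ring_of_integers j iota -> injective iota.
Proof.
move=> [_ _ jE] a b ab; apply/eqP; rewrite -tofrac_eq; apply/eqP.
have : in_alg K' (tofrac a) = in_alg K' (tofrac b) by rewrite -!jE ab.
exact: fmorph_inj.
Qed.

Theorem proposition4p23
  (O : idomainType) (pi : O) (kappa : finFieldType)
  (res : {rmorphism O -> kappa}) (q : nat)
  (K' : fieldExtType {fraction O}) (O' : idomainType) (pi' : O')
  (j : {rmorphism O' -> K'}) (iota : {rmorphism O -> O'})
  (kappa' : finFieldType) (res' : {rmorphism O' -> kappa'}) (r : nat)
  (W : witt_scheme pi q) (W' : witt_scheme pi' (q ^ r))
  (u : ring_morphism (base_change iota W) W')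
  (O_dvr : is_dvr O) (pi_unif : is_uniformizer pi) (O_complete : is_complete pi)
  (kappa_res : is_residue_field res) (card_kappa : #|kappa| = q)
  (O'_int : is_ring_of_integers j iota) (pi'_unif : is_uniformizer pi')
  (kappa'_res : is_residue_field res') (card_kappa' : #|kappa'| = (q ^ r)%N)
  (O'_unramified : is_unramified iota) (u_drinfeld : is_drinfeld u) :
  let u_s := base_change_mor res' u in
  [/\ universal_homeomorphism (ring_kmorphism u_s),
      pro_infinitesimal (kernel u_s)
    & isomorphic (kernel u_s)
        (Spec (quot_alg (A := poly_alg kappa')
           [set indet kappa' i ^+ (q ^ (i * r.-1)) | i in [set: nat]]))].
Proof.
move=> u_s.
have iota_inj := ring_of_integers_inj O'_int.
have [pi0 pi'0 [d piE d_unit]] :=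
  unramified_uniformizers O_dvr pi_unif pi'_unif iota_inj O'_unramified.
have [res'_surj res'_0] := kappa'_res.
have res_pi' : res' pi' = 0.
  by apply/res'_0; rewrite pi'_unif; exists 1; rewrite mul1r.
have res_d : res' d != 0.
  by apply/eqP => /res'_0; rewrite /nonunits /= d_unit.
have [p p_prime p_kappa] := finPcharP kappa.
have [a qpE] : exists a, q = (p ^ a)%N.
  exists (logn p #|kappa|); rewrite -card_kappa.
  exact: (card_pprimeChar p_kappa).
have q_gt0 : (0 < q)%N by rewrite qpE expn_gt0 prime_gt0.
have a_gt0 : (0 < a)%N.
  have := finNzRing_gt1 kappa; rewrite card_kappa qpE.
  by case: (a).
have r_gt0 : (0 < r)%N.
  by have := finNzRing_gt1 kappa'; rewrite card_kappa'; case: (r).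
have p0 : p%:R = 0 :> kappa'.
  have /(card_finPcharP)/(_ p_prime) : #|kappa'| = (p ^ (a * r))%N.
    by rewrite card_kappa' qpE expnM.
  by rewrite inE => /andP[_ /eqP].
have [c qE] : exists c, q%:R = pi' * c.
  have : nonunits (q%:R : O').
    apply/res'_0; rewrite rmorph_nat qpE -(prednK a_gt0) expnS natrM p0.
    by rewrite mul0r.
  by rewrite pi'_unif => -[c ->]; exists c; rewrite mulrC.
have [w [w_nat w_inj w_u]] := drinfeld_special_fiber q_gt0 r_gt0 pi'0 piE qE
  res_pi' res_d u_drinfeld.
pose F := base_change res' (base_change iota W).
pose x (B : algebra kappa') (b : F B) : nat -> B :=
  witt_coord (b : W (restrict iota (restrict res' B))).
have x_inj B : injective (x B) by exact: witt_coord_inj.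
have x_surj (B : algebra kappa') v : exists b, x B b = v.
  exact: (@witt_coord_surj _ _ _ W (restrict iota (restrict res' B)) v).
have x_push (A B : algebra kappa') (h : alg_hom A B) (b : F A) i :
  x B (rpush F h b) i = h (x A b i).
  exact: (@witt_push_coord _ _ _ W _ _
    (restrict_hom iota (restrict_hom res' h)) b i).
have x0 B i : x B 0 i = 0.
  exact: (@witt_coord0 _ _ _ W pi0 q_gt0 (restrict iota (restrict res' B))).
have xD B n (b b' c' c'' : F B) : agree n (x B b) (x B b') ->
    agree n (x B c') (x B c'') -> agree n (x B (b + c')) (x B (b' + c'')).
  exact: (@witt_coordD_agree _ _ _ W pi0 (restrict iota (restrict res' B))).
have w_ux B (b : F B) n : w B (u_s B b) n = x B b n ^+ (q ^ (n * r.-1)).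
  exact: w_u.
have e_gt0 i : (0 < q ^ (i * r.-1))%N by rewrite expn_gt0 q_gt0.
(* zero is the image of the zero vector, whose coordinates vanish *)
have w0 B i : w B 0 i = 0.
  by rewrite -(rmorph0 (u_s B)) w_ux x0 expr0n -leqn0 leqNgt e_gt0.
clearbody x.
pose y (B : algebra kappa') (b : kernel u_s B) : nat -> B := x B (sval b).
have y_nat : natural_coords (F := kernel u_s) y.
  by move=> A B h b i; rewrite /y /= x_push.
have y_inj B : injective (y B).
  by move=> b b' /x_inj bb'; apply: ker_ext.
have y_nil B b i : y B b i ^+ (q ^ (i * r.-1)) = 0.
  by rewrite /y -w_ux (svalP b) w0.
have y_surj (B : algebra kappa') v : (forall i, v i ^+ (q ^ (i * r.-1)) = 0) ->
    exists b, y B b = v.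
  move=> v0; have [b bE] := x_surj B v.
  have ub : u_s B b = 0.
    by apply: w_inj; apply: funext => i; rewrite w_ux bE v0 w0.
  by exists (exist _ b ub).
split.
- have x_bij B : bijective (x B).
    have /choice[g gE] := x_surj B; exists g => // b.
    by apply: x_inj; rewrite gE.
  apply: (@frobenius_universal_homeomorphism kappa' p
    (fun i => (a * (i * r.-1))%N) (ring_kfunctor F)
    (ring_kfunctor (base_change res' W')) (ring_kmorphism u_s) x w p_prime p0
    x_push w_nat x_bij w_inj) => B b n.
  by rewrite expnM -qpE; apply: w_ux.
- apply: (truncated_coords_pro_infinitesimal e_gt0 y_nat y_inj y_nil y_surj).
  by move=> B n b b' c' c''; apply: xD.
- exact: (Spec_truncated y_nat y_inj y_nil y_surj).
Qed.
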